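(* Let $\mathcal{P}^{(1)}$ and $\mathcal{P}^{(2)}$ be PTRSs with $\Sigma^{\mathcal{P}^{(1)}}\cap\Sigma^{\mathcal{P}^{(2)}}=\emptyset$. Then $\mathtt{SAST}(\xrightarrow{\mathbf{i}}_{\mathcal{P}^{(1)}\cup\mathcal{P}^{(2)}})$ holds if and only if both $\mathtt{SAST}(\xrightarrow{\mathbf{i}}_{\mathcal{P}^{(1)}})$ and $\mathtt{SAST}(\xrightarrow{\mathbf{i}}_{\mathcal{P}^{(2)}})$ hold.
   Context: For a PTRS $\mathcal{P}$, $\Sigma^{\mathcal{P}}$ is the set of function symbols occurring in its rules, and $\mathcal{P}$ is considered on terms over $\Sigma^{\mathcal{P}}$ and a countable variable set. $\mathrm{FDist}(A)$: finite multisets of pairs $(p:a)$, $0<p\le1$, probabilities summing to 1; $p\cdot\mu$ as usual. A PTRS is a countable set of rules $\ell\to\mu$, $\ell$ non-variable, $\mu$ a finite multi-distribution on terms, variables of terms in $\mu$ among those of $\ell$. $t\xrightarrow{\mathbf{i}}_{\mathcal{P}}\{p_1:t_1,\dots,p_k:t_k\}$ iff $t|_\pi=\ell\sigma$, $t_j=t[r_j\sigma]_\pi$ for a position $\pi$, rule $\ell\to\{p_1:r_1,\dots,p_k:r_k\}\in\mathcal{P}$, substitution $\sigma$, with all proper subterms of $\ell\sigma$ normal forms. Lifting $\rightrightarrows$ of $\to$: smallest relation on multi-distributions with $\{1:t\}\rightrightarrows\{1:t\}$ for normal forms, $\{1:t\}\rightrightarrows\mu$ if $t\to\mu$, closed under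 $\bigcup_jp_j\cdot\mu_j\rightrightarrows\bigcup_jp_j\cdot\nu_j$ ($\sum p_j=1$). $|\mu|_\to$: total probability of normal forms; $\mathrm{edl}((\mu_n))=\sum_{n\ge0}(1-|\mu_n|_\to)$; $\mathrm{edh}_\to(t)=\sup\{\mathrm{edl}(\vec\mu)\mid\vec\mu$ an infinite $\rightrightarrows$-sequence with $\mu_0=\{1:t\}\}$. $\mathtt{SAST}(\to)$: $\mathrm{edh}_\to(t)<\infty$ for every term $t$. *)

(* Defs.v *)
From HB Require Import structures.
From mathcomp Require Import all_boot all_order all_algebra.
From mathcomp Require Import finmap multiset.
From mathcomp Require Import all_classical all_reals all_analysis.

Set Implicit Arguments.
Unset Strict Implicit.
Unset Printing Implicit Defensive.

Import Order.TTheory GRing.Theory Num.Theory.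

Local Open Scope classical_set_scope.
Local Open Scope ring_scope.

(** * Finite multi-distributions *)

Section MultiDistributions.
Context {R : realType}.

Definition is_fdist (T : choiceType) (m : {mset R * T}%mset) : Prop :=
  (forall x, x \in m -> 0 < x.1 <= 1) /\ \sum_(x <- m) x.1 = 1.

Record fdist (T : choiceType) := FDist {
  fdist_mset :> {mset R * T}%mset ;
  fdistP : is_fdist fdist_mset }.

Lemma is_fdist1 (T : choiceType) (t : T) : is_fdist [mset (1 : R, t)]%mset.
Proof.
split=> [x|]; first by rewrite in_mset1 => /eqP -> /=; rewrite ltr01 lexx.
by rewrite enum_msetn big_seq1.
Qed.

Definition fdist1 (T : choiceType) (t : T) : fdist T := FDist (is_fdist1 t).

(* Both operations below keep multiplicities, as they map the enumeration of
   the multiset, in which an element occurs as often as in the multiset. *)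
Definition mset_scale (T : choiceType) (p : R) (m : {mset R * T}%mset) :
    {mset R * T}%mset :=
  seq_mset [seq (p * x.1, x.2) | x <- (m : seq (R * T))].

Definition mset_map (T U : choiceType) (f : T -> U) (m : {mset R * T}%mset) :
    {mset R * U}%mset :=
  seq_mset [seq (x.1, f x.2) | x <- (m : seq (R * T))].

Lemma is_fdist_map (T U : choiceType) (f : T -> U) (mu : fdist T) :
  is_fdist (mset_map f mu).
Proof.
have [mu01 mu1] := fdistP mu; split=> [x|].
  rewrite (perm_mem (perm_eq_seq_mset _)) => /mapP[y ymu ->] /=.
  exact: mu01.
by rewrite (perm_big _ (perm_eq_seq_mset _)) big_map.
Qed.

Definition fdist_map (T U : choiceType) (f : T -> U) (mu : fdist T) : fdist U :=
  FDist (is_fdist_map f mu).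

End MultiDistributions.

Arguments fdist R T : clear implicits.

(** * Probabilistic abstract reduction *)

Section Reduction.
Context {R : realType} {T : choiceType}.
Variable to : T -> fdist R T -> Prop.

Definition normal_form (t : T) : Prop := ~ exists mu, to t mu.

Inductive lifting : fdist R T -> fdist R T -> Prop :=
| lifting_nf t : normal_form t -> lifting (fdist1 t) (fdist1 t)
| lifting_step t mu : to t mu -> lifting (fdist1 t) mu
| lifting_union (k : nat) (p : 'I_k -> R) (mu nu : 'I_k -> fdist R T)
    (M N : fdist R T) :
    (forall j, 0 < p j) -> \sum_(j < k) p j = 1 ->
    (forall j, lifting (mu j) (nu j)) ->
    M = \big[msetD/mset0]_(j < k) mset_scale (p j) (mu j) :> {mset R * T}%mset ->
    N = \big[msetD/mset0]_(j < k) mset_scale (p j) (nu j) :> {mset R * T}%mset ->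
    lifting M N.

Definition nf_prob (mu : fdist R T) : R :=
  \sum_(x <- mu | `[< normal_form x.2 >]) x.1.

Definition edl (mu : nat -> fdist R T) : \bar R :=
  (\sum_(0 <= n <oo) (1 - nf_prob (mu n))%:E)%E.

Definition lifting_seq (mu : nat -> fdist R T) : Prop :=
  forall n, lifting (mu n) (mu n.+1).

Definition edh (t : T) : \bar R :=
  ereal_sup [set edl mu | mu in [set mu | lifting_seq mu /\ mu 0%N = fdist1 t]].

(* [D] is the set of objects on which the relation is considered. *)
Definition SAST (D : set T) : Prop := forall t, D t -> (edh t < +oo)%E.

End Reduction.

(** * Terms *)

Record signature := Signature { symbol :> Type ; arity : symbol -> nat }.

Section Terms.
Variable F : signature.

Inductive term :=
| Var of nat
| App (f : F) of ('I_(arity f) -> term).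

HB.instance Definition _ := gen_eqMixin term.
HB.instance Definition _ := gen_choiceMixin term.

Fixpoint vars (t : term) : set nat :=
  match t with
  | Var x => [set x]
  | App f ts => \bigcup_i vars (ts i)
  end.

Fixpoint symbols (t : term) : set F :=
  match t with
  | Var x => set0
  | App f ts => f |` \bigcup_i symbols (ts i)
  end.

Definition terms_over (S : set F) : set term := [set t | symbols t `<=` S].

Fixpoint subst (s : nat -> term) (t : term) : term :=
  match t with
  | Var x => s x
  | App f ts => App (fun i => subst s (ts i))
  end.

(* Argument positions are numbered from 0; the result is [None] when [pi] is
   not a position of [t]. *)
Fixpoint subterm_at (t : term) (pi : seq nat) : option term :=
  match pi, t with
  | [::], _ => Some t
  | i :: pi', App f ts =>
      if insub i is Some j then subterm_at (ts j) pi' else None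
  | _ :: _, Var _ => None
  end.

(* Only meaningful when [pi] is a position of [t]. *)
Fixpoint replace_at (t : term) (pi : seq nat) (u : term) : term :=
  match pi, t with
  | [::], _ => u
  | i :: pi', App f ts =>
      App (fun j => if val j == i then replace_at (ts j) pi' u else ts j)
  | _ :: _, Var _ => t
  end.

Definition proper_subterm (s t : term) : Prop :=
  exists2 pi, pi <> [::] & subterm_at t pi = Some s.

End Terms.

(** * Probabilistic term rewrite systems *)

Section PTRS.
Context {R : realType} {F : signature}.

Definition rule : Type := term F * fdist R (term F).

Definition is_PTRS (P : set rule) : Prop :=
  countable P /\
  forall l mu, P (l, mu) ->
    (forall x, l <> Var F x) /\
    (forall x, x \in (mu : {mset _}%mset) -> vars x.2 `<=` vars l).

Definition ptrs_symbols (P : set rule) : set F :=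
  [set f | exists l mu, P (l, mu) /\
    (symbols l f \/ exists2 x, x \in (mu : {mset _}%mset) & symbols x.2 f)].

Definition ptrs_terms (P : set rule) : set (term F) :=
  terms_over (ptrs_symbols P).

Definition rewrite_step (P : set rule) (t : term F) (nu : fdist R (term F)) :
    Prop :=
  exists pi l mu s, [/\ P (l, mu),
    subterm_at t pi = Some (subst s l) &
    nu = fdist_map (fun r => replace_at t pi (subst s r)) mu].

Definition innermost_step (P : set rule) (t : term F) (nu : fdist R (term F)) :
    Prop :=
  exists pi l mu s, [/\ P (l, mu),
    subterm_at t pi = Some (subst s l),
    nu = fdist_map (fun r => replace_at t pi (subst s r)) mu &
    forall u, proper_subterm u (subst s l) -> normal_form (rewrite_step P) u].

End PTRS.

Arguments rule R F : clear implicits.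

(* Main.v *)
Require Import Defs.
From mathcomp Require Import all_boot all_order all_algebra.
From mathcomp Require Import finmap multiset.
From mathcomp Require Import all_classical all_reals all_analysis.
From mathcomp Require Import zify.

(** SAST of a relation on a closed set of objects is equivalent to the existence
    of a real-valued ranking function [W >= 0] with [1 + E_mu W <= W t] for every
    step from [t] to [mu]: [W] is the expected derivation height.  Hence SAST of
    the union passes to each component, and conversely it suffices to build, from
    a ranking function [v1] of [P1], a function that no innermost step of the
    union increases in expectation and that steps with [P1]-rules decrease by at
    least 1; adding the symmetric function for [P2] ranks the union.

    Call a subterm with no [P1]-symbol at its root an alien.  An alien in normal
    form acts as a variable for the [P1]-layer above it, up to equality of aliens.
    An alien that is not yet in normal form ends as an atom of unknown identity or
    collapses to one of the [P1]-layers inside it; innermost evaluation never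
    copies it before it is in normal form, so there are only finitely many
    outcomes.  Replacing the aliens of a [P1]-layer in all possible ways gives a
    finite list of pure [P1]-terms, and the potential is the sum of [v1] over
    these lists.  The outcomes must be summed: the choice among them may depend on
    the random results, so that a supremum would not be superharmonic.  Normal
    aliens are named by a coding into [K] variables, which has to be extended as
    new ones appear; taking the infimum over all codings of the current term makes
    the potential independent of the history. *)

Set Implicit Arguments.
Unset Strict Implicit.
Unset Printing Implicit Defensive.

Import Order.TTheory GRing.Theory Num.Theory.

Local Open Scope classical_set_scope.
Local Open Scope ring_scope.

(** * Ranking functions *)

Section Mixtures.
Context {R : realType} {T : choiceType}.
Implicit Types (mu nu : fdist R T) (A B : {mset R * T}%mset).

Lemma perm_msetD A B : perm_eq (A `+` B)%mset ((A : seq _) ++ B).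
Proof.
apply/allP => x _ /=.
by rewrite count_cat !count_mem_mset msetE2.
Qed.

Lemma perm_big_msetD I (r : seq I) (G : I -> {mset R * T}%mset) :
  perm_eq (\big[msetD/mset0]_(i <- r) G i) (flatten [seq (G i : seq _) | i <- r]).
Proof.
elim: r => [|i r IH]; first by rewrite big_nil enum_mset0.
rewrite big_cons /=; apply: perm_trans (perm_msetD _ _) _.
by rewrite perm_cat2l.
Qed.

Lemma perm_mset_scale (p : R) A :
  perm_eq (mset_scale p A) [seq (p * x.1, x.2) | x <- (A : seq (R * T))].
Proof. exact: perm_eq_seq_mset. Qed.

Lemma sum_mixture k (p : 'I_k -> R) (mu : 'I_k -> {mset R * T}%mset)
    (Q : pred T) (w : T -> R) :
  \sum_(x <- \big[msetD/mset0]_(j < k) mset_scale (p j) (mu j) | Q x.2)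
     x.1 * w x.2 =
  \sum_(j < k) p j * \sum_(x <- mu j | Q x.2) x.1 * w x.2.
Proof.
rewrite (perm_big _ (perm_big_msetD _ _)) big_flatten big_map.
apply: eq_bigr => j _.
rewrite (perm_big _ (perm_mset_scale _ _)) big_map mulr_sumr.
by apply: eq_bigr => x _; rewrite mulrA.
Qed.

Lemma in_mixture k (p : 'I_k -> R) (mu : 'I_k -> {mset R * T}%mset) x :
  x \in \big[msetD/mset0]_(j < k) mset_scale (p j) (mu j) ->
  exists j y, [/\ y \in mu j & x = (p j * y.1, y.2)].
Proof.
rewrite (perm_mem (perm_big_msetD _ _)) => /flattenP[s /mapP[j _ ->]].
rewrite (perm_mem (perm_mset_scale _ _)) => /mapP[y ymu ->].
by exists j, y.
Qed.

Lemma mixture_in k (p : 'I_k -> R) (mu : 'I_k -> {mset R * T}%mset) j y :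
  y \in mu j ->
  (p j * y.1, y.2) \in \big[msetD/mset0]_(j < k) mset_scale (p j) (mu j).
Proof.
move=> ymu; rewrite (perm_mem (perm_big_msetD _ _)); apply/flattenP.
exists (mset_scale (p j) (mu j) : seq _).
  by apply/mapP; exists j; rewrite ?mem_index_enum.
by rewrite (perm_mem (perm_mset_scale _ _)); apply/mapP; exists y.
Qed.

Lemma is_fdist_mixture k (p : 'I_k -> R) (mu : 'I_k -> fdist R T) :
  (forall j, 0 < p j) -> \sum_(j < k) p j = 1 ->
  is_fdist (\big[msetD/mset0]_(j < k) mset_scale (p j) (mu j)).
Proof.
move=> p0 p1; split=> [x /in_mixture[j [y [ymu ->]]]|].
  have [/(_ _ ymu)/andP[y0 y1] _] := fdistP (mu j).
  rewrite /= mulr_gt0 //= mulr_ile1 ?(ltW y0) ?(ltW (p0 j)) //.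
  by rewrite -p1 (bigD1 j) //= lerDl sumr_ge0 // => i _; rewrite ltW.
transitivity (\sum_(x <- \big[msetD/mset0]_(j < k) mset_scale (p j) (mu j))
  x.1 * 1); first by apply: eq_bigr => x _; rewrite mulr1.
rewrite (sum_mixture p mu xpredT (fun=> 1)) -[RHS]p1; apply: eq_bigr => j _.
under eq_bigr do rewrite mulr1.
by rewrite (fdistP (mu j)).2 mulr1.
Qed.

Definition mixture k (p : 'I_k -> R) (mu : 'I_k -> fdist R T)
    (p0 : forall j, 0 < p j) (p1 : \sum_(j < k) p j = 1) : fdist R T :=
  FDist (is_fdist_mixture mu p0 p1).

Lemma fdist_ext mu nu : mu = nu :> {mset R * T}%mset -> mu = nu.
Proof.
by case: mu nu => [m hm] [n hn] /= e; move: hm hn; rewrite e => hm hn; congr FDist;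
  exact: Prop_irrelevance.
Qed.

(** Every multi-distribution is thus a convex combination of point masses, the shape that the union
    rule of the lifting works on. *)
Lemma mixture_fdist1 k (s : k.-tuple (R * T)) :
  \big[msetD/mset0]_(j < k)
     mset_scale (tnth s j).1 (fdist1 (R := R) (tnth s j).2) = seq_mset s.
Proof.
apply/eqP; rewrite -[X in X == _]seq_mset_id; apply/eqP/eq_seq_msetP.
apply: perm_trans (perm_big_msetD _ _) _.
rewrite -[X in perm_eq _ X]map_tnth_enum /index_enum -enumT.
elim: (enum _) => [//|j r IH] /=.
rewrite -cat1s; apply: perm_cat; last exact: IH.
apply: perm_trans (perm_mset_scale _ _) _.
by rewrite enum_msetn /= mulr1 -surjective_pairing.
Qed.

End Mixtures.

(** * Equivalence of SAST with the existence of a ranking function *)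

Section Ranking.
Context {R : realType} {T : choiceType}.
Variable to : T -> fdist R T -> Prop.
Implicit Types (mu nu M N : fdist R T) (D : set T) (W : T -> R).

Definition expect W mu : R := \sum_(x <- mu) x.1 * W x.2.

Definition step_closed D : Prop :=
  forall t mu, D t -> to t mu -> forall x, x \in (mu : {mset _}%mset) -> D x.2.

(** A Lyapunov ranking function for the probabilistic relation restricted to [D]. *)
Definition ranking D W : Prop :=
  forall t, D t -> 0 <= W t /\ forall mu, to t mu -> 1 + expect W mu <= W t.

Definition supported D mu : Prop :=
  forall x, x \in (mu : {mset _}%mset) -> D x.2.

Lemma expect_fdist1 W t : expect W (fdist1 t) = W t.
Proof. by rewrite /expect enum_msetn big_seq1 mul1r. Qed.

Lemma expect_mixture k (p : 'I_k -> R) (mu : 'I_k -> fdist R T) W M :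
  M = \big[msetD/mset0]_(j < k) mset_scale (p j) (mu j) :> {mset R * T}%mset ->
  expect W M = \sum_(j < k) p j * expect W (mu j).
Proof. by move=> e; rewrite /expect e (sum_mixture p mu xpredT W). Qed.

Lemma nf_prob_mixture k (p : 'I_k -> R) (mu : 'I_k -> fdist R T) M :
  M = \big[msetD/mset0]_(j < k) mset_scale (p j) (mu j) :> {mset R * T}%mset ->
  nf_prob to M = \sum_(j < k) p j * nf_prob to (mu j).
Proof.
move=> e; rewrite /nf_prob e.
have h (m : {mset R * T}%mset) : \sum_(x <- m | `[< normal_form to x.2 >]) x.1 =
    \sum_(x <- m | `[< normal_form to x.2 >]) x.1 * 1.
  by apply: eq_bigr => x _; rewrite mulr1.
rewrite h (sum_mixture p mu (fun t => `[< normal_form to t >]) (fun=> 1)).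
by apply: eq_bigr => j _; rewrite -h.
Qed.

Lemma nf_prob_nf t : normal_form to t -> nf_prob to (fdist1 t) = 1.
Proof.
by move=> nft; rewrite /nf_prob enum_msetn big_cons big_nil /= asboolT // addr0.
Qed.

Lemma nf_prob_red t mu : to t mu -> nf_prob to (fdist1 t) = 0.
Proof.
move=> tmu; rewrite /nf_prob enum_msetn big_cons big_nil /= asboolF //.
by apply; exists mu.
Qed.

Lemma nf_prob_le1 mu : nf_prob to mu <= 1.
Proof.
have [h0 h1] := fdistP mu; rewrite -h1 /nf_prob big_mkcond /=.
rewrite !big_seq; apply: ler_sum => x /h0/andP[x0 _].
by case: ifP => // _; exact: ltW.
Qed.

(** Each lifting step pays for one summand of [edl]: reducible mass loses at least one unit per
    step, and all terms involved are affine in mixtures. *)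
Lemma lifting_expect D W M N : step_closed D -> ranking D W ->
  lifting to M N -> supported D M ->
  supported D N /\ (1 - nf_prob to M) + expect W N <= expect W M.
Proof.
move=> cD rW; elim=> {M N}.
- by move=> t nft Dt; split=> //; rewrite nf_prob_nf // subrr add0r.
- move=> t mu tmu Dt.
  have {}Dt : D t by apply: (Dt (1, t)); rewrite in_mset1.
  split; first exact: cD Dt tmu.
  by rewrite (nf_prob_red tmu) subr0 expect_fdist1; case: (rW _ Dt) => _; apply.
- move=> k p mu nu M N p0 p1 _ IH eM eN DM.
  have Dmu j : supported D (mu j).
    by move=> y ymu; apply: (DM (p j * y.1, y.2)); rewrite eM mixture_in.
  split.
    move=> x; rewrite eN => /in_mixture[j [y [ynu ->]]].
    exact: (IH j (Dmu j)).1 _ ynu.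
  rewrite (expect_mixture W eM) (expect_mixture W eN) (nf_prob_mixture eM) -p1.
  rewrite -sumrB -big_split /=; apply: ler_sum => j _.
  rewrite -[X in X - _](mulr1 (p j)) -mulrBr -mulrDr ler_wpM2l ?(ltW (p0 j)) //.
  exact: (IH j (Dmu j)).2.
Qed.

Lemma expect_ge0 D W mu : ranking D W -> supported D mu -> 0 <= expect W mu.
Proof.
move=> rW Dmu; rewrite /expect big_seq; apply: sumr_ge0 => x xmu.
have [/(_ _ xmu)/andP[x0 _] _] := fdistP mu.
by rewrite mulr_ge0 ?(ltW x0) //; case: (rW _ (Dmu _ xmu)).
Qed.

(** Telescoping: the partial sums of [edl] plus the current expectation of [W] never exceed
    [W t]. *)
Lemma ranking_SAST D W : step_closed D -> ranking D W -> SAST to D.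
Proof.
move=> cD rW t Dt; apply: (@le_lt_trans _ _ (W t)%:E); last exact: ltry.
apply: ge_ereal_sup => _ [mu [lmu mu0] <-].
have h n : supported D (mu n) /\
  \sum_(0 <= i < n) (1 - nf_prob to (mu i)) + expect W (mu n) <= W t.
  elim: n => [|n [IH1 IH2]].
    rewrite big_geq // add0r mu0 expect_fdist1; split=> // x.
    by rewrite in_mset1 => /eqP ->.
  have [h1 h2] := lifting_expect cD rW (lmu n) IH1.
  by split=> //; rewrite big_nat_recr //= -addrA; apply: le_trans IH2; rewrite lerD2l.
apply: lime_le.
  by apply: is_cvg_nneseries => n _ _; rewrite lee_fin subr_ge0 nf_prob_le1.
near=> n; rewrite sumEFin lee_fin; have [h1 h2] := h n.
by apply: le_trans h2; rewrite lerDl (expect_ge0 rW h1).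
Unshelve. all: by end_near.
Qed.

Lemma lifting_mixture k (p : 'I_k -> R) (mu nu : 'I_k -> fdist R T)
    (p0 : forall j, 0 < p j) (p1 : \sum_(j < k) p j = 1) :
  (forall j, lifting to (mu j) (nu j)) ->
  lifting to (mixture mu p0 p1) (mixture nu p0 p1).
Proof. by move=> h; apply: (lifting_union p0 p1 h). Qed.

Lemma fdist_mixtureP mu : exists (k : nat) (s : k.-tuple (R * T)),
  [/\ mu = seq_mset s :> {mset R * T}%mset,
   forall j, 0 < (tnth s j).1 & \sum_(j < k) (tnth s j).1 = 1].
Proof.
exists (size mu), (in_tuple mu); have [h0 h1] := fdistP mu; split.
- by rewrite /= seq_mset_id.
- by move=> j; have /h0/andP[] := mem_tnth j (in_tuple mu).
- by rewrite -[RHS]h1 -[in RHS](in_tupleE mu) big_tuple.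
Qed.

Lemma lifting_total mu : exists nu, lifting to mu nu.
Proof.
have h t : exists nu, lifting to (fdist1 t) nu.
  have [[nu tnu]|nft] := pselect (exists nu, to t nu).
    by exists nu; exact: lifting_step.
  by exists (fdist1 t); exact: lifting_nf.
have [k [s [emu p0 p1]]] := fdist_mixtureP mu.
have [nu hnu] := choice h.
exists (mixture (fun j => nu (tnth s j).2) p0 p1).
have -> : mu = mixture (fun j => fdist1 (tnth s j).2) p0 p1.
  by apply: fdist_ext; rewrite emu /= mixture_fdist1.
exact: lifting_mixture.
Qed.

Lemma lifting_seq_from t :
  exists mu : nat -> fdist R T, lifting_seq to mu /\ mu 0%N = fdist1 t.
Proof.
have [nxt hnxt] := choice lifting_total.
by exists (fun n => iter n nxt (fdist1 t)); split=> // n; exact: hnxt.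
Qed.

Lemma edl_ge0 (mu : nat -> fdist R T) : (0 <= edl to mu)%E.
Proof.
by apply: nneseries_ge0 => n _ _; rewrite lee_fin subr_ge0 nf_prob_le1.
Qed.

Lemma edh_ge0 t : (0 <= edh to t)%E.
Proof.
have [mu hmu] := lifting_seq_from t.
by apply: le_trans (edl_ge0 mu) _; apply: ereal_sup_ubound; exists mu.
Qed.

Lemma edl_le_edh (mu : nat -> fdist R T) t :
  lifting_seq to mu -> mu 0%N = fdist1 t -> (edl to mu <= edh to t)%E.
Proof. by move=> h1 h2; apply: ereal_sup_ubound; exists mu. Qed.

(** A Bellman inequality: after the first step, the sequences chosen for the outcomes run in
    parallel as one mixture. *)
Lemma edl_step t k (s : k.-tuple (R * T)) mu (nu : 'I_k -> nat -> fdist R T) :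
  to t mu -> mu = seq_mset s :> {mset R * T}%mset ->
  (forall j, 0 < (tnth s j).1) -> \sum_(j < k) (tnth s j).1 = 1 ->
  (forall j, lifting_seq to (nu j) /\ nu j 0%N = fdist1 (tnth s j).2) ->
  (1 + \sum_(j < k) (tnth s j).1%:E * edl to (nu j) <= edh to t)%E.
Proof.
move=> tmu emu p0 p1 hnu.
(* The parallel run is delayed by one index to make room for [t]; the summand at index 0 contributes
   the 1. *)
pose M n := if n is n'.+1 then mixture (fun j => nu j n') p0 p1 else fdist1 t.
have M1 : M 1%N = mu.
  apply: fdist_ext; rewrite emu /= -mixture_fdist1.
  by apply: eq_bigr => j _; rewrite (hnu j).2.
have hM : lifting_seq to M.
  case=> [|n]; first by rewrite M1; exact: lifting_step.
  by apply: lifting_mixture => j; exact: (hnu j).1.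
apply: le_trans (edl_le_edh hM erefl).
have ge0 (x : nat -> fdist R T) n : (0 <= (1 - nf_prob to (x n))%:E)%E.
  by rewrite lee_fin subr_ge0 nf_prob_le1.
rewrite /edl nneseries_recl //=.
rewrite (nf_prob_red tmu) subr0 leeD2l //.
rewrite -nneseries_addn; last by move=> n; exact: (ge0 M).
rewrite [leRHS](eq_eseriesr (g := fun n =>
   \sum_(j < k) (tnth s j).1%:E * (1 - nf_prob to (nu j n))%:E)%E); last first.
  move=> n _; rewrite addn1 /= sumEFin; congr _%:E.
  rewrite (nf_prob_mixture (p := fun j => (tnth s j).1)
    (mu := fun j => nu j n) (M := mixture (fun j => nu j n) p0 p1) erefl)
    -[X in X - _]p1 -sumrB.
  by apply: eq_bigr => j _; rewrite mulrBr mulr1.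
rewrite nneseries_sum; last first.
  by move=> j n _; rewrite mule_ge0 // lee_fin ltW.
by apply: lee_sum => j _; rewrite nneseriesZl // => n _; exact: (ge0 (nu j)).
Qed.

Lemma SAST_ranking D : step_closed D -> SAST to D ->
  ranking D (fun t => fine (edh to t)).
Proof.
move=> cD hD.
have fin t : D t -> edh to t \is a fin_num.
  by move=> Dt; rewrite ge0_fin_numE ?edh_ge0 // hD.
move=> t Dt; split; first by apply: fine_ge0; exact: edh_ge0.
move=> mu tmu; have [k [s [emu p0 p1]]] := fdist_mixtureP mu.
have Ds j : D (tnth s j).2.
  apply: (cD _ _ Dt tmu); rewrite emu (perm_mem (perm_eq_seq_mset _)).
  exact: mem_tnth.
have -> : expect (fun t => fine (edh to t)) mu =
    \sum_(j < k) (tnth s j).1 * fine (edh to (tnth s j).2).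
  by rewrite /expect emu (perm_big _ (perm_eq_seq_mset _)) big_tuple.
(* The supremum need not be attained, so each outcome gets a sequence within [e] of it; the
   probabilities sum to 1, so the total loss is again [e]. *)
apply/ler_addgt0Pr => e e0.
have near_opt j : exists nu : nat -> fdist R T,
    (lifting_seq to nu /\ nu 0%N = fdist1 (tnth s j).2)
    /\ (edh to (tnth s j).2 - e%:E < edl to nu)%E.
  have [_ [nu hnu <-] lt] := ub_ereal_sup_adherent e0 (fin _ (Ds j)).
  by exists nu.
have [nu hnu] := choice near_opt.
have := edl_step tmu emu p0 p1 (fun j => (hnu j).1).
rewrite -(fineK (fin _ Dt)) => h.
rewrite -lerBlDr -lee_fin; apply: le_trans h.
have -> : (1 + \sum_(j < k) (tnth s j).1 * fine (edh to (tnth s j).2) - e)%:E =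
    (1 + \sum_(j < k) (tnth s j).1%:E * (edh to (tnth s j).2 - e%:E))%E.
  rewrite -addrA EFinD; congr (_ + _)%E.
  rewrite (eq_bigr (fun j => ((tnth s j).1 *
    (fine (edh to (tnth s j).2) - e))%:E)); last first.
    by move=> j _; rewrite -{1}(fineK (fin _ (Ds j))).
  rewrite sumEFin; congr _%:E.
  under [RHS]eq_bigr do rewrite mulrBr.
  by rewrite sumrB -mulr_suml p1 mul1r.
rewrite leeD2l //; apply: lee_sum => j _.
by rewrite lee_wpmul2l ?lee_fin ?ltW // (hnu j).2.
Qed.

End Ranking.

(** * Contexts *)

Section Contexts.
Context {F : signature}.
Implicit Types (t u x y : term F).

(** Contexts replace positions, since they allow structural recursion. The entry [ts i] on the path
    is overwritten by [fill]. *)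
Inductive ctx :=
| Hole
| CApp (f : F) (i : 'I_(arity f)) (ts : 'I_(arity f) -> term F) (c : ctx).

Fixpoint fill (c : ctx) x : term F :=
  match c with
  | Hole => x
  | CApp f i ts c' => App (fun j => if j == i then fill c' x else ts j)
  end.

Fixpoint ctx_comp (c d : ctx) : ctx :=
  match c with
  | Hole => d
  | CApp f i ts c' => CApp i ts (ctx_comp c' d)
  end.

Fixpoint ctx_pos (c : ctx) : seq nat :=
  match c with
  | Hole => [::]
  | CApp f i ts c' => val i :: ctx_pos c'
  end.

Fixpoint ctx_depth (c : ctx) : nat :=
  if c is CApp f i ts c' then (ctx_depth c').+1 else 0%N.

Lemma fill_comp c d x : fill (ctx_comp c d) x = fill c (fill d x).
Proof.
elim: c => //= f i ts c IH; congr App; apply: funext => j.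
by rewrite IH.
Qed.

Lemma App_fill f (ts : 'I_(arity f) -> term F) i :
  App ts = fill (CApp i ts Hole) (ts i).
Proof. by congr App; apply: funext => j /=; case: eqP => // ->. Qed.

Lemma subterm_at_ctx t pi u : subterm_at t pi = Some u ->
  exists c, t = fill c u /\ forall y, replace_at t pi y = fill c y.
Proof.
elim: pi t => [|i pi IH] t /=; first by case: t => [?|? ?] [<-]; exists Hole.
case: t => [//|f ts] /=; case: (insubP 'I_(arity f) i) => //= j _ ej /IH[c [ec hc]].
exists (CApp j ts c); split=> [|y] /=.
  by congr App; apply: funext => k; case: eqP => // ->.
congr App; apply: funext => k; rewrite -ej.
by rewrite val_eqE; case: eqP => // ->; rewrite hc.
Qed.

Lemma subterm_at_fill c u : subterm_at (fill c u) (ctx_pos c) = Some u.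
Proof.
by elim: c => [|f i ts c IH] /=; [case: u | rewrite valK eqxx].
Qed.

Lemma replace_at_fill c u y : replace_at (fill c u) (ctx_pos c) y = fill c y.
Proof.
elim: c => [|f i ts c IH] /=; first by case: u.
congr App; apply: funext => k; rewrite val_eqE.
by case: eqP => // ->; rewrite IH.
Qed.

Lemma subst_eq_on s s' t :
  (forall v, vars t v -> s v = s' v) -> subst s t = subst s' t.
Proof.
elim: t => [v|f ts IH] h /=; first exact: h.
by congr App; apply: funext => i; apply: IH => v hv; apply: h; exists i.
Qed.

Lemma symbols_subst s t g : symbols (subst s t) g ->
  symbols t g \/ exists2 v, vars t v & symbols (s v) g.
Proof.
elim: t => [v|f ts IH] /=; first by right; exists v.
case=> [->|[i _ /IH[h|[v hv h]]]]; first by left; left.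
  by left; right; exists i.
by right; exists v => //; exists i.
Qed.

Lemma symbols_subst_var s t g v :
  vars t v -> symbols (s v) g -> symbols (subst s t) g.
Proof.
elim: t => [w|f ts IH] /=; first by move=> ->.
by case=> i _ /IH h /h; right; exists i.
Qed.

Lemma symbols_fill_swap c u y g :
  symbols (fill c y) g -> symbols (fill c u) g \/ symbols y g.
Proof.
elim: c => [|f i ts c IH] /=; first by right.
case=> [->|[j _]]; first by left; left.
case: eqP => [ej /IH[h|h]|nj h].
- by left; right; exists j => //; rewrite ej eqxx.
- by right.
- by left; right; exists j => //; case: eqP nj.
Qed.

Lemma symbols_fill_hole c u g : symbols u g -> symbols (fill c u) g.
Proof.
by elim: c => //= f i ts c IH /IH h; right; exists i => //; rewrite eqxx.
Qed.

End Contexts.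
Arguments ctx F : clear implicits.

(** * Normal forms and innermost steps in terms of contexts *)

Section Rewriting.
Context {R : realType} {F : signature}.
Implicit Types (P : set (rule R F)) (t u x y : term F).

Notation nf P := (normal_form (rewrite_step P)).

Lemma nfP P t : nf P t <->
  forall c l mu s, P (l, mu) -> t <> fill c (subst s l).
Proof.
split=> [h c l mu s Plm et|h [nu [pi [l [mu [s [Plm]]]]]]].
  apply: h; exists (fdist_map (fun r => replace_at t (ctx_pos c) (subst s r)) mu).
  by exists (ctx_pos c), l, mu, s; split=> //; rewrite et subterm_at_fill.
by move=> /subterm_at_ctx[c [ec _]] _; exact: (h c l mu s).
Qed.

Lemma nf_sub P c u : nf P (fill c u) -> nf P u.
Proof.
move=> /nfP h; apply/nfP => d l mu s Plm eu.
by apply: (h (ctx_comp c d) l mu s Plm); rewrite fill_comp eu.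
Qed.

Lemma nf_arg P f (ts : 'I_(arity f) -> term F) i : nf P (App ts) -> nf P (ts i).
Proof. by rewrite (App_fill ts i) => /nf_sub. Qed.

Lemma proper_subterms_nf P f (ts : 'I_(arity f) -> term F) :
  (forall u, proper_subterm u (App ts) -> nf P u) <-> forall i, nf P (ts i).
Proof.
split=> [h i|h u [[|i pi] // _ /=]].
  by apply: h; exists [:: val i] => //=; rewrite valK /=; case: (ts i).
by case: (insubP 'I_(arity f) i) => // j _ _ /subterm_at_ctx[c [ec _]];
  apply: (@nf_sub _ c); rewrite -ec.
Qed.

Lemma innermost_stepP P t nu : innermost_step P t nu <->
  exists c l mu s, [/\ P (l, mu), t = fill c (subst s l),
    nu = fdist_map (fun r => fill c (subst s r)) mu &
    forall u, proper_subterm u (subst s l) -> nf P u].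
Proof.
split=> [[pi [l [mu [s [Plm /subterm_at_ctx[c [ec hc]] -> hp]]]]]|].
  exists c, l, mu, s; split=> //.
  by congr fdist_map; apply: funext => r; rewrite hc.
move=> [c [l [mu [s [Plm -> -> hp]]]]]; exists (ctx_pos c), l, mu, s.
split=> //; first by rewrite subterm_at_fill.
by congr fdist_map; apply: funext => r; rewrite replace_at_fill.
Qed.

Lemma expect_map (W : term F -> R) (g : term F -> term F) (mu : fdist R (term F)) :
  expect W (fdist_map g mu) = expect (fun r => W (g r)) mu.
Proof. by rewrite /expect (perm_big _ (perm_eq_seq_mset _)) big_map. Qed.

(** A symbol of the result comes from the context, from a right-hand side, or from the image of a
    variable that also occurs on the left. *)
Lemma ptrs_terms_closed P : is_PTRS P ->
  step_closed (innermost_step P) (ptrs_terms P).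
Proof.
move=> [_ hP] t nu Dt /innermost_stepP[c [l [mu [s [Plm et -> _]]]]] x.
rewrite (perm_mem (perm_eq_seq_mset _)) => /mapP[z zmu -> /=] g.
case/(@symbols_fill_swap _ c (subst s l)); first by rewrite -et; exact: Dt.
case/symbols_subst => [h|[v hv h]]; first by exists l, mu; split=> //; right; exists z.
apply: Dt; rewrite et; apply: symbols_fill_hole.
apply: symbols_subst_var h; exact: (hP _ _ Plm).2 _ zmu _ hv.
Qed.

End Rewriting.

(** * Layers *)

Section Layers.
Context {F : signature}.
Variable A : set F.
Implicit Types (t u v x y : term F) (c D : ctx F) (cc b d : bool).

(* Variables count as aliens. *)
Definition side t : bool := if t is App f _ then `[< A f >] else false.

(* The subterms at the top of a maximal layer of side [cc], with multiplicity;
   [b] is the side of the symbol above [t]. *)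
Fixpoint lroots cc b t : seq (term F) :=
  (if (side t == cc) && (b != cc) then [:: t] else [::]) ++
  match t with
  | Var _ => [::]
  | App f ts => flatten [seq lroots cc `[< A f >] (ts i) | i <- enum 'I_(arity f)]
  end.

(** The flag only decides whether the root is listed; with flag [cc] exactly the roots strictly
    below it remain. *)
Lemma lrootsE cc b t :
  lroots cc b t =
    (if (side t == cc) && (b != cc) then [:: t] else [::]) ++ lroots cc cc t.
Proof. by case: t => [n|f ts] /=; rewrite eqxx andbF. Qed.

Lemma lroots_App cc f (ts : 'I_(arity f) -> term F) u :
  u \in lroots cc cc (App ts) <-> exists i, u \in lroots cc `[< A f >] (ts i).
Proof.
rewrite /= eqxx andbF /=; split=> [/flattenP[s /mapP[i _ ->] us]|[i us]].
  by exists i.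
by apply/flattenP; exists (lroots cc `[< A f >] (ts i)) => //;
  apply/mapP; exists i; rewrite ?mem_enum.
Qed.

Lemma lroots_flag cc b t : {subset lroots cc cc t <= lroots cc b t}.
Proof. by move=> u hu; rewrite lrootsE mem_cat hu orbT. Qed.

Lemma lroots_flagN cc b t : {subset lroots cc b t <= lroots cc (~~ cc) t}.
Proof.
move=> u; rewrite (lrootsE _ b) (lrootsE _ (~~ cc)) !mem_cat.
case: ifP => [/andP[-> _]|_ /= ->]; last by rewrite orbT.
by case: (cc).
Qed.

Lemma lroots_fill cc b t u : u \in lroots cc b t -> exists c, t = fill c u.
Proof.
elim: t b => [n|f ts IH] b; rewrite lrootsE mem_cat => /orP[].
- by case: ifP => // _; rewrite inE => /eqP ->; exists Hole.
- by rewrite /= eqxx andbF.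
- by case: ifP => // _; rewrite inE => /eqP ->; exists Hole.
- move=> /lroots_App[i /IH[c ec]]; exists (CApp i ts c) => /=.
  by congr App; apply: funext => j; case: eqP => // ->.
Qed.

Lemma lroots_side cc b t u : u \in lroots cc b t -> side u = cc.
Proof.
elim: t b => [n|f ts IH] b; rewrite lrootsE mem_cat => /orP[].
- by case: ifP => // /andP[/eqP <- _]; rewrite inE => /eqP ->.
- by rewrite /= eqxx andbF.
- by case: ifP => // /andP[/eqP <- _]; rewrite inE => /eqP ->.
- by move=> /lroots_App[i /IH].
Qed.

Lemma lroots_mem cc b t u : u \in lroots cc b t ->
  u = t \/ u \in lroots cc cc t.
Proof.
rewrite lrootsE mem_cat => /orP[|->]; last by right.
by case: ifP => // _; rewrite inE => /eqP ->; left.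
Qed.

(** The root of [u] lies on the side of [A] and is not listed itself; everything below it has the
    same parent symbol in [u] as in [t]. *)
Lemma lroots_trans b b' t u : u \in lroots true b t ->
  {subset lroots false b' u <= lroots false false t}.
Proof.
move=> hu; have su := lroots_side hu.
move=> w; rewrite lrootsE su /= => hw; move: hu.
elim: t b => [n|f ts IH] b /lroots_mem[<- //|]; first by [].
move=> /lroots_App[i /IH h]; apply/lroots_App; exists i.
exact: lroots_flag.
Qed.

Definition one_sided d t : Prop := forall g, symbols t g -> `[< A g >] = d.

Lemma one_sided_arg d f (ts : 'I_(arity f) -> term F) :
  one_sided d (App ts) -> `[< A f >] = d /\ forall i, one_sided d (ts i).
Proof.
move=> h; split=> [|i g hg]; apply: h; first by left.
by right; exists i.
Qed.

(** A one-sided term below a symbol of its own side starts no layer, so all roots come from the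
    substitution. Only membership is compared, because repeated variables copy roots. *)
Lemma lroots_subst_same d r s u : one_sided d r ->
  u \in lroots d d (subst s r) <-> exists2 v, vars r v & u \in lroots d d (s v).
Proof.
elim: r => [n|f ts IH] hr; first by split=> [h|[v -> //]]; exists n.
have [hf hts] := one_sided_arg hr; rewrite [subst _ _]/=; split.
  move=> /lroots_App[i]; rewrite hf => /(IH i (hts i))[v hv h].
  by exists v => //; exists i.
move=> [v [i _ hv] h]; apply/lroots_App; exists i; rewrite hf.
by apply/(IH i (hts i)); exists v.
Qed.

Lemma lroots_subst_other cc r s u : one_sided (~~ cc) r ->
  u \in lroots cc (~~ cc) (subst s r) <->
  exists2 v, vars r v & u \in lroots cc (~~ cc) (s v).
Proof.
elim: r => [n|f ts IH] hr; first by split=> [h|[v -> //]]; exists n.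
have [hf hts] := one_sided_arg hr.
rewrite lrootsE mem_cat [side _]/= hf; have -> : (~~ cc == cc) = false by case: (cc).
rewrite andFb in_nil orFb [subst _ _]/=; split.
  move=> /lroots_App[i]; rewrite hf => /(IH i (hts i))[v hv h].
  by exists v => //; exists i.
move=> [v [i _ hv] h]; apply/lroots_App; exists i; rewrite hf.
by apply/(IH i (hts i)); exists v.
Qed.

Fixpoint ctx_flag b c : bool :=
  if c is CApp f i ts c' then ctx_flag `[< A f >] c' else b.

Fixpoint ctx_sibs cc b c : seq (term F) :=
  if c is CApp f i ts c' then
    flatten [seq lroots cc `[< A f >] (ts j) | j <- rem i (enum 'I_(arity f))] ++
    ctx_sibs cc `[< A f >] c'
  else [::].

(* The layer roots of [fill c x] that contain the hole strictly inside, as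
   contexts, hence independently of [x]. *)
Fixpoint ctx_roots cc b c : seq (ctx F) :=
  if c is CApp f i ts c' then
    (if (`[< A f >] == cc) && (b != cc) then [:: c] else [::]) ++
    ctx_roots cc `[< A f >] c'
  else [::].

Lemma ctx_roots_depth cc b c :
  all (fun D => ctx_depth D <= ctx_depth c)%N (ctx_roots cc b c).
Proof.
elim: c b => //= f i ts c IH b; rewrite all_cat; apply/andP; split.
  by case: ifP => //= _; rewrite leqnn.
by apply: sub_all (IH `[< A f >]) => D; exact: leqW.
Qed.

(** Splits the layer roots into those beside the path to the hole, those in the inserted term, and
    those on the path. A rewrite step leaves the first group untouched. *)
Lemma perm_lroots_fill cc b c x :
  perm_eq (lroots cc b (fill c x))
    (ctx_sibs cc b c ++ lroots cc (ctx_flag b c) x ++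
     [seq fill D x | D <- ctx_roots cc b c]).
Proof.
elim: c b => [|f i ts c IH] b; first by rewrite /= cats0.
rewrite lrootsE /= eqxx andbF cat0s.
set h := if _ then [:: App _] else _.
set G := fun j => lroots cc `[< A f >] (if j == i then fill c x else ts j).
have eG : perm_eq (flatten [seq G j | j <- enum 'I_(arity f)])
   (lroots cc `[< A f >] (fill c x) ++
    flatten [seq lroots cc `[< A f >] (ts j) | j <- rem i (enum 'I_(arity f))]).
  have := perm_to_rem (mem_enum 'I_(arity f) i).
  move=> /(perm_map G)/perm_flatten/perm_trans; apply.
  rewrite /= {1}/G eqxx perm_cat2l.
  suff -> : [seq G j | j <- rem i (enum 'I_(arity f))] =
    [seq lroots cc `[< A f >] (ts j) | j <- rem i (enum 'I_(arity f))] by [].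
  apply/eq_in_map => j; rewrite mem_rem_uniq ?enum_uniq // inE => /andP[/negPf h' _].
  by rewrite /G h'.
rewrite map_cat.
have -> : [seq fill D x | D <- if (`[< A f >] == cc) && (b != cc)
     then [:: CApp i ts c] else [::]] = h by rewrite /h; case: ifP.
apply: perm_trans (perm_cat (perm_refl h) eG) _.
set S := flatten _; set Cs := ctx_sibs _ _ _; set X := lroots _ _ x.
have := IH `[< A f >]; rewrite -/Cs -/X; set Y := lroots _ _ (fill c x) => hY.
apply: perm_trans (perm_cat (perm_refl h) (perm_cat hY (perm_refl S))) _.
rewrite -!catA; set M := [seq fill D x | D <- _].
apply/permP => p; rewrite !count_cat.
by rewrite !addnA -!addnA; lia.
Qed.

End Layers.

(** * Redexes and layer roots *)

Section DedupSum.
Context {R : realType} {T : choiceType}.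
Variable p : pred T.
Implicit Types (G H L : seq T) (psi : T -> R).

(* Normal forms can be copied by a step, so they are counted as a set; all other
   occurrences have to be counted with multiplicity, since they evolve
   independently of each other. *)
Definition dedup_sum psi G : R :=
  \sum_(u <- undup [seq u <- G | p u]) psi u + \sum_(u <- G | ~~ p u) psi u.

Lemma perm_dedup_sum psi G H :
  perm_eq G H -> dedup_sum psi G = dedup_sum psi H.
Proof.
move=> GH; rewrite /dedup_sum (perm_big _ GH); congr (_ + _); apply: perm_big.
by apply: perm_undup => u; rewrite !mem_filter (perm_mem GH).
Qed.

Lemma eq_in_dedup_sum psi psi' G :
  {in G, psi =1 psi'} -> dedup_sum psi G = dedup_sum psi' G.
Proof.
move=> h; rewrite /dedup_sum; congr (_ + _).
  by apply: eq_big_seq => u; rewrite mem_undup mem_filter => /andP[_ /h].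
by rewrite big_seq_cond [RHS]big_seq_cond; apply: eq_bigr => u /andP[/h].
Qed.

Lemma dedup_sum_catN psi G H : all (predC p) H ->
  dedup_sum psi (G ++ H) = dedup_sum psi G + \sum_(u <- H) psi u.
Proof.
move=> hH; rewrite /dedup_sum filter_cat big_cat /= addrA.
have -> : [seq u <- H | p u] = [::].
  by apply/eqP; rewrite -[_ == _]negbK -has_filter -all_predC.
rewrite cats0.
congr (_ + _ + _); rewrite big_seq_cond [RHS]big_seq; apply: eq_bigl => u.
by case: (boolP (u \in H)) => //= uH; exact: (allP hH _ uH).
Qed.

Lemma sum_undup_sub psi G H : (forall u, 0 <= psi u) -> {subset G <= H} ->
  \sum_(u <- undup G) psi u <= \sum_(u <- undup H) psi u.
Proof.
move=> psi0 GH.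
have e : perm_eq (undup G) [seq u <- undup H | u \in G].
  apply: uniq_perm; rewrite ?filter_uniq ?undup_uniq // => u.
  rewrite mem_filter !mem_undup.
  by case: (boolP (u \in G)) => //= /GH.
by rewrite (perm_big _ e) big_filter [leRHS](bigID (mem G)) /= lerDl sumr_ge0.
Qed.

Lemma sum_undup_le psi G : (forall u, 0 <= psi u) ->
  \sum_(u <- undup G) psi u <= \sum_(u <- G) psi u.
Proof.
move=> psi0; elim: G => [//|u G IH] /=; rewrite big_cons.
case: ifP => _; last by rewrite big_cons lerD2l.
by apply: le_trans IH _; rewrite lerDr.
Qed.

Lemma dedup_sum_cat_le psi G H : (forall u, 0 <= psi u) ->
  dedup_sum psi (G ++ H) <= dedup_sum psi G + \sum_(u <- H) psi u.
Proof.
move=> psi0; rewrite /dedup_sum filter_cat undup_cat !big_cat /=.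
rewrite [\sum_(u <- H) _](bigID p) /=.
rewrite [leRHS]addrACA lerD2r lerD //.
  by rewrite big_filter [leRHS](bigID [pred u | u \notin [seq v <- H | p v]])
    /= lerDl sumr_ge0.
by apply: le_trans (sum_undup_le _ psi0) _; rewrite big_filter.
Qed.

(** Counting normal forms as a set pays off here: copying or erasing them never raises the sum. *)
Lemma dedup_sum_subset psi L G H : (forall u, 0 <= psi u) ->
  all p H -> {subset G <= H} ->
  dedup_sum psi (L ++ G) <= dedup_sum psi (L ++ H).
Proof.
move=> psi0 hH GH; rewrite /dedup_sum; apply: lerD.
  apply: sum_undup_sub => // u; rewrite !mem_filter !mem_cat.
  by case/andP=> -> /= /orP[->//|/GH ->]; rewrite orbT.
rewrite !big_cat lerD2l /= big_seq_cond big1 ?sumr_ge0 //.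
by move=> u /andP[/GH/(allP hH) ->].
Qed.

Lemma dedup_sum_ge0 psi G : (forall u, 0 <= psi u) -> 0 <= dedup_sum psi G.
Proof. by move=> h; rewrite addr_ge0 ?sumr_ge0. Qed.

Lemma dedup_sum_mem psi G u : (forall u, 0 <= psi u) -> u \in G ->
  psi u <= dedup_sum psi G.
Proof.
move=> psi0 uG; rewrite /dedup_sum; have [pu|pu] := boolP (p u).
  rewrite (bigD1_seq u) ?undup_uniq ?mem_undup ?mem_filter ?pu //=.
  by rewrite -addrA lerDl addr_ge0 ?sumr_ge0.
rewrite [X in _ + X](perm_big _ (perm_to_rem uG)) big_cons pu.
by rewrite addrCA lerDl addr_ge0 ?sumr_ge0.
Qed.

End DedupSum.

Lemma sum1_size_seq {R : realType} {T : Type} (G : seq T) :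
  \sum_(u <- G) 1 = (size G)%:R :> R.
Proof. by rewrite big_const_seq count_predT iter_addr_0. Qed.

(** * Layer roots before and after contracting an innermost redex *)

Section Redex.
Context {R : realType} {F : signature}.
Variables (A : set F) (P : set (rule R F)).
Variables (d : bool) (l : term F) (s : nat -> term F) (mu : fdist R (term F)).
Hypothesis Plm : P (l, mu).
Hypothesis l_nonvar : forall v, l <> Var F v.
Hypothesis l_sided : one_sided A d l.
Hypothesis args_nf :
  forall u, proper_subterm u (subst s l) -> normal_form (rewrite_step P) u.
Implicit Types (c D : ctx F) (cc b : bool) (r : term F) (psi : term F -> R).

Local Notation x := (subst s l).

Definition nfb (t : term F) : bool := `[< normal_form (rewrite_step P) t >].

Lemma redex_not_nf D : ~~ nfb (fill D x).
Proof. by apply/asboolP => /nfP h; exact: (h D l mu s). Qed.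

Lemma redex_side : side A x = d.
Proof.
case: l l_nonvar l_sided => [v /(_ v)//|f ls _ /one_sided_arg[hf _]].
by rewrite -hf.
Qed.

Lemma redex_inner_nf cc : all nfb (lroots A cc cc x).
Proof.
move: args_nf; case: l l_nonvar => [v /(_ v)//|f ls _] /proper_subterms_nf h.
apply/allP => u /lroots_App[i /lroots_fill[c ec]]; apply/asboolP.
by apply: (@nf_sub _ _ _ c); rewrite -ec.
Qed.

(* The redex itself, if it is a layer root below a symbol of side [b]. *)
Definition hole_root cc b : seq (ctx F) :=
  if (d == cc) && (b != cc) then [:: Hole] else [::].

Lemma lroots_redex cc b :
  lroots A cc b x = [seq fill D x | D <- hole_root cc b] ++ lroots A cc cc x.
Proof. by rewrite lrootsE redex_side /hole_root; case: ifP. Qed.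

(** A collapsing reduct may lose the root at the hole, hence the case [h' = [::]]. All other roots
    come from matched variables, so they already lie strictly inside the redex. *)
Lemma lroots_reduct r cc b : one_sided A d r -> vars r `<=` vars l ->
  exists h' rest,
    [/\ lroots A cc b (subst s r) = [seq fill D (subst s r) | D <- h'] ++ rest,
      h' = hole_root cc b \/ h' = [::] & {subset rest <= lroots A cc cc x}].
Proof.
move=> hr rl; rewrite /hole_root; have [ed|nd] := eqVneq d cc.
  have rest : {subset lroots A cc cc (subst s r) <= lroots A cc cc x}.
    move=> u; rewrite -ed => /(lroots_subst_same _ _ hr)[v /rl hv hu].
    by apply/(lroots_subst_same _ _ l_sided); exists v.
  rewrite lrootsE; case: (boolP (b != cc)) => hb.
    case: ifP => _; first by
      exists [:: Hole], (lroots A cc cc (subst s r)); split; auto.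
    by exists [::], (lroots A cc cc (subst s r)); split; auto.
  by rewrite andbF; exists [::], (lroots A cc cc (subst s r)); split; auto.
have ed : d = ~~ cc by case: (d) (cc) nd => [] [].
exists [::], (lroots A cc b (subst s r)); split; auto.
move=> u /lroots_flagN; rewrite -ed => h.
have : u \in lroots A cc (~~ cc) x.
  move: h; rewrite ed => /lroots_subst_other -/(_ _); rewrite -ed.
  move=> /(_ hr)[v /rl hv hu].
  have := l_sided; rewrite ed => hl; apply/(lroots_subst_other _ _ hl).
  by exists v => //; rewrite -ed.
by rewrite lrootsE redex_side (negPf nd).
Qed.

(** The roots containing the redex are reducible, so they escape deduplication and can be compared
    one by one with their reducts. *)
Lemma dedup_sum_redex psi cc b c :
  dedup_sum nfb psi (lroots A cc b (fill c x)) =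
  dedup_sum nfb psi (ctx_sibs A cc b c ++ lroots A cc cc x) +
  \sum_(D <- ctx_roots A cc b c ++ hole_root cc (ctx_flag A b c)) psi (fill D x).
Proof.
rewrite (perm_dedup_sum _ _ (perm_lroots_fill A cc b c x)) lroots_redex.
rewrite -(big_map (fill^~ x) xpredT psi) -dedup_sum_catN; last first.
  rewrite all_map (eq_all (a2 := predT)) ?all_predT // => D.
  by rewrite /= redex_not_nf.
apply: perm_dedup_sum; rewrite map_cat; apply/permP => q; rewrite !count_cat.
lia.
Qed.

Lemma dedup_sum_reduct psi cc b c r : (forall u, 0 <= psi u) ->
  one_sided A d r -> vars r `<=` vars l ->
  dedup_sum nfb psi (lroots A cc b (fill c (subst s r))) <=
  dedup_sum nfb psi (ctx_sibs A cc b c ++ lroots A cc cc x) +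
  \sum_(D <- ctx_roots A cc b c ++ hole_root cc (ctx_flag A b c))
     psi (fill D (subst s r)).
Proof.
move=> psi0 hr rl.
have [h' [rest [e hh' hrest]]] := lroots_reduct cc (ctx_flag A b c) hr rl.
rewrite (perm_dedup_sum _ _ (perm_lroots_fill A cc b c (subst s r))) e.
rewrite (@perm_dedup_sum _ _ _ _ _ ((ctx_sibs A cc b c ++ rest) ++
  [seq fill D (subst s r) | D <- ctx_roots A cc b c ++ h'])); last first.
  by apply/permP => q; rewrite map_cat !count_cat; lia.
apply: le_trans (dedup_sum_cat_le _ _ _ psi0) _; apply: lerD.
  exact: dedup_sum_subset (redex_inner_nf cc) hrest.
rewrite big_map !big_cat /= lerD2l.
by case: hh' => -> //; rewrite big_nil sumr_ge0.
Qed.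

(** Bounds the codes needed on both sides of a step: a root that newly becomes normal contained the
    redex and was therefore counted separately before. *)
Lemma size_nf_roots_reduct cc b c r : one_sided A d r -> vars r `<=` vars l ->
  (size (undup ([seq u <- lroots A cc b (fill c x) | nfb u] ++
                [seq u <- lroots A cc b (fill c (subst s r)) | nfb u])))%:R <=
  dedup_sum nfb (fun=> 1) (lroots A cc b (fill c x)) :> R.
Proof.
move=> hr rl.
have [h' [rest [e hh' hrest]]] := lroots_reduct cc (ctx_flag A b c) hr rl.
set G := ctx_sibs A cc b c ++ lroots A cc cc x.
set Dy := [seq fill D (subst s r) | D <- ctx_roots A cc b c ++ h'].
have one0 (u : term F) : 0 <= 1 :> R by rewrite ler01.
rewrite -sum1_size_seq; apply: (@le_trans _ _
  (\sum_(u <- undup [seq u <- G ++ Dy | nfb u]) 1)).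
  apply: sum_undup_sub => // u; rewrite mem_cat !mem_filter -andb_orr.
  case/andP=> nfu; rewrite nfu /=.
  rewrite (perm_mem (perm_lroots_fill A cc b c x)).
  rewrite (perm_mem (perm_lroots_fill A cc b c _)) e lroots_redex.
  rewrite /G /Dy map_cat !mem_cat.
  have noD (Ds : seq (ctx F)) : (u \in [seq fill D x | D <- Ds]) = false.
    apply/negP; elim: Ds => //= D Ds IH; rewrite inE => /orP[/eqP eu|//].
    by move: (redex_not_nf D); rewrite -eu nfu.
  rewrite !noD /= orbF => /orP[/orP[->|->]|/orP[->|/orP[/orP[->|/hrest ->]|->]]];
    by rewrite ?orbT.
apply: (@le_trans _ _ (dedup_sum nfb (fun=> 1) (G ++ Dy))).
  by rewrite /dedup_sum lerDl sumr_ge0.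
apply: le_trans (dedup_sum_cat_le _ _ _ one0) _.
rewrite dedup_sum_redex -/G lerD2l /Dy big_map !big_cat /= lerD2l.
by case: hh' => -> //; rewrite big_nil sumr_ge0.
Qed.

End Redex.

(** * Pure instances of a layer *)

Section Products.
Context {R : realType} {T : Type}.

Definition upd n (b : 'I_n -> T) (i : 'I_n) (a : T) : 'I_n -> T :=
  fun j => if j == i then a else b j.

(** A Cartesian product kept as a list, so that multiplicities count in sums; [b] supplies the
    coordinates outside [s]. *)
Fixpoint prodl n (L : 'I_n -> seq T) (s : seq 'I_n) (b : 'I_n -> T) :
    seq ('I_n -> T) :=
  if s is i :: s' then flatten [seq prodl L s' (upd b i a) | a <- L i]
  else [:: b].

Lemma eq_in_prodl n (L L' : 'I_n -> seq T) s b :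
  {in s, L =1 L'} -> prodl L s b = prodl L' s b.
Proof.
elim: s b => [//|i s IH] b h /=; rewrite -(h i) ?mem_head //.
congr flatten; apply: eq_map => a; apply: IH => j js.
by apply: h; rewrite inE js orbT.
Qed.

Lemma prodl_sing n (g : 'I_n -> T) s b :
  prodl (fun i => [:: g i]) s b = [:: fun j => if j \in s then g j else b j].
Proof.
elim: s b => [//|i s IH] b /=; rewrite IH /= /upd; congr cons; apply: funext => j.
by rewrite inE; case: (j \in s); [rewrite orbT|rewrite orbF; case: eqP => // ->].
Qed.

Lemma prodl_size n (L : 'I_n -> seq T) s b :
  (forall i, 0 < size (L i))%N -> (0 < size (prodl L s b))%N.
Proof.
move=> hL; elim: s b => [//|i s IH] b /=.
by case: (L i) (hL i) => //= a La _; rewrite size_cat ltn_addr.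
Qed.

Lemma all_prodl n (L : 'I_n -> seq T) s b (q : pred T) :
  (forall i, all q (L i)) -> (forall i, q (b i)) ->
  all (fun b' : 'I_n -> T => [forall i, q (b' i)]) (prodl L s b).
Proof.
move=> hL; elim: s b => [|i s IH] b hb /=; first by rewrite andbT; apply/forallP.
move: (hL i); elim: (L i) => //= a La IHa /andP[qa qLa].
rewrite all_cat IHa // andbT; apply: IH => j; rewrite /upd.
by case: ifP.
Qed.

Lemma sum_prodl_upd n (L : 'I_n -> seq T) s b i a (psi : ('I_n -> T) -> R) :
  i \notin s -> \sum_(b' <- prodl L s (upd b i a)) psi b' =
  \sum_(b' <- prodl L s b) psi (upd b' i a).
Proof.
elim: s b => [|j s IH] b; first by rewrite !big_cons !big_nil.
rewrite inE negb_or => /andP[ij is_] /=; rewrite !big_flatten /= !big_map.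
apply: eq_bigr => a' _; rewrite -IH //; congr (\sum_(b' <- prodl L s _) _).
apply: funext => k; rewrite /upd.
by case: (k =P j) => [->|//]; rewrite eq_sym (negPf ij).
Qed.

(** Isolates the coordinate of the argument in which the redex lies. *)
Lemma sum_prodl_rem n (L : 'I_n -> seq T) s b i (psi : ('I_n -> T) -> R) :
  uniq s -> i \in s -> \sum_(b' <- prodl L s b) psi b' =
  \sum_(b' <- prodl L (rem i s) b) \sum_(a <- L i) psi (upd b' i a).
Proof.
elim: s b => [//|j s IH] b /andP[js us]; rewrite inE.
have [-> _|ij /= is_] := eqVneq i j.
  rewrite /= eqxx big_flatten big_map [RHS]exchange_big; apply: eq_bigr => a _.
  exact: sum_prodl_upd.
rewrite [j == i]eq_sym (negPf ij) /= !big_flatten /= !big_map.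
by apply: eq_bigr => a _; rewrite IH.
Qed.

End Products.

(** * Abstraction of aliens and the options of a layer *)

Section Options.
Context {R : realType} {F : signature}.
Variables (A : set F) (P : set (rule R F)) (K : nat).
Implicit Types (e : term F -> nat) (t u : term F) (phi : term F -> R).

(* Aliens are named by their code. *)
Fixpoint abst e t : term F :=
  match t with
  | Var _ => Var F (e t)
  | App f ts => if `[< A f >] then App (fun i => abst e (ts i)) else Var F (e t)
  end.

(* First component: the pure terms into which [t] may evolve, seen from the layer
   above it.  An alien that is not in normal form becomes any of the [K] atoms or
   collapses to one of the [P1]-layers inside it.  The second component collects
   the options of those inner layers that are not in normal form. *)
Fixpoint optp e t : seq (term F) * (bool -> seq (term F)) :=
  match t with
  | Var _ => ([:: Var F (e t)], fun=> [::])
  | App f ts =>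
    let below b := flatten [seq (optp e (ts i)).2 b | i <- enum 'I_(arity f)] in
    let o :=
      if `[< A f >] then
        [seq App b | b <- prodl (fun i => (optp e (ts i)).1) (enum 'I_(arity f))
                            (fun=> Var F 0)]
      else if nfb P t then [:: Var F (e t)]
      else [seq Var F k | k <- iota 0 K] ++
           [seq abst e u | u <- undup [seq u <- lroots A true false t | nfb P u]]
           ++ below false in
    (o, fun b => (if `[< A f >] && ~~ b && ~~ nfb P t then o else [::]) ++
                 below `[< A f >])
  end.

Definition opt e t := (optp e t).1.
Definition opt_sum e phi t : R := \sum_(a <- opt e t) phi a.

Lemma opt_A e f (ts : 'I_(arity f) -> term F) : `[< A f >] ->
  opt e (App ts) = [seq App b | b <- prodl (fun i => opt e (ts i))
    (enum 'I_(arity f)) (fun=> Var F 0)].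
Proof. by rewrite /opt /= => ->. Qed.

(** The second component of [optp] exists to make the inner layers, which are not direct arguments,
    reachable by structural recursion. *)
Lemma sum_optp2 e phi t b :
  \sum_(a <- (optp e t).2 b) phi a =
  \sum_(u <- lroots A true b t | ~~ nfb P u) opt_sum e phi u.
Proof.
elim: t b => [n|f ts IH] b; first by rewrite /= !big_nil.
rewrite lrootsE /= ?eqxx andbF cat0s !big_cat /=; congr (_ + _); last first.
  by rewrite !big_flatten !big_map; apply: eq_bigr => i _; exact: IH.
rewrite eqb_id; case: (asboolP (A f)) => //= hf; last by rewrite !big_nil.
case: b => /=; first by rewrite !big_nil.
rewrite big_mkcond big_cons big_nil addr0; case: ifP => _; last by rewrite big_nil.
by rewrite /opt_sum opt_A //; exact/asboolP.
Qed.

(** Once every alien is normal, no choice is left. *)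
Lemma opt_resolved e t : all (nfb P) (lroots A false true t) ->
  opt e t = [:: abst e t].
Proof.
elim: t => [//|f ts IH] h; rewrite /opt /=.
case: (asboolP (A f)) => hf; last first.
  have /allP/(_ (App ts)) := h.
  by rewrite lrootsE mem_cat [side _ _]/= asboolF // mem_head => /(_ isT) ->.
rewrite (_ : (fun i => (optp e (ts i)).1) = fun i => [:: abst e (ts i)]); last first.
  apply: funext => i; apply: IH; apply/allP => u hu; apply: (allP h).
  apply: lroots_flag; apply/lroots_App; exists i; rewrite asboolT //.
rewrite prodl_sing /=; congr [:: App _]; apply: funext => i.
by rewrite mem_enum.
Qed.

Lemma nfb_lroots cc b t : nfb P t -> all (nfb P) (lroots A cc b t).
Proof.
move=> /asboolP nft; apply/allP => u /lroots_fill[c ec]; apply/asboolP.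
by apply: (@nf_sub _ _ _ c); rewrite -ec.
Qed.

Lemma opt_sum_alien e phi f (ts : 'I_(arity f) -> term F) :
  ~~ `[< A f >] -> ~~ nfb P (App ts) ->
  opt_sum e phi (App ts) = \sum_(k <- iota 0 K) phi (Var F k) +
    dedup_sum (nfb P) (opt_sum e phi) (lroots A true false (App ts)).
Proof.
move=> hf hnf; rewrite /opt_sum /opt.
have -> : (optp e (App ts)).1 = [seq Var F k | k <- iota 0 K] ++
  [seq abst e u | u <- undup [seq u <- lroots A true false (App ts) | nfb P u]]
  ++ (optp e (App ts)).2 false by rewrite /= (negPf hf) (negPf hnf).
rewrite 2!big_cat 2!big_map sum_optp2 /dedup_sum; congr (_ + (_ + _)).
apply: eq_big_seq => u; rewrite mem_undup mem_filter => /andP[hu _].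
by rewrite -/(opt e u) opt_resolved ?nfb_lroots // big_seq1.
Qed.

Lemma opt_sum_ge0 e phi t : (forall a, 0 <= phi a) -> 0 <= opt_sum e phi t.
Proof. by move=> h; exact: sumr_ge0. Qed.

(** Used for the reduct of an alien, whatever it has become: a layer after a collapse, an atom among
    the [K] ones, or still a reducible alien. Each case is covered by the options that a reducible
    alien offers. *)
Lemma opt_sum_le e phi t : (forall a, 0 <= phi a) -> (forall u, e u < K)%N ->
  opt_sum e phi t <= \sum_(k <- iota 0 K) phi (Var F k) +
    dedup_sum (nfb P) (opt_sum e phi) (lroots A true false t).
Proof.
move=> phi0 eK; have osum0 u := opt_sum_ge0 e u phi0.
have [st|nst] := boolP (side A t).
  have mt : t \in lroots A true false t by rewrite lrootsE mem_cat st mem_head.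
  by apply: le_trans (dedup_sum_mem (nfb P) osum0 mt) _; rewrite lerDr sumr_ge0.
have le_var : phi (Var F (e t)) <= \sum_(k <- iota 0 K) phi (Var F k) +
    dedup_sum (nfb P) (opt_sum e phi) (lroots A true false t).
  rewrite (bigD1_seq (e t)) ?iota_uniq ?mem_iota ?eK //= -addrA lerDl.
  by rewrite addr_ge0 ?sumr_ge0 ?dedup_sum_ge0.
case: t nst le_var => [n|f ts] nst le_var; first by rewrite {1}/opt_sum big_seq1.
have [hnf|hnf] := boolP (nfb P (App ts)); last by rewrite opt_sum_alien.
by rewrite {1}/opt_sum opt_resolved ?nfb_lroots // big_seq1
  [abst _ _]/= (negPf (nst : ~~ `[< A f >])).
Qed.

Lemma opt_size e t : (0 < K)%N -> (0 < size (opt e t))%N.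
Proof.
move=> K0; elim: t => [//|f ts IH]; rewrite /opt /=.
case: ifP => _; first by rewrite size_map prodl_size.
by case: ifP => // _; rewrite size_cat size_map size_iota ltn_addr.
Qed.

Definition pureb t : bool := `[< terms_over A t >].

Lemma pure_App f (ts : 'I_(arity f) -> term F) :
  A f -> (forall i, pureb (ts i)) -> pureb (App ts).
Proof.
move=> hf h; apply/asboolP => g [->//|[i _]]; exact: (asboolW (h i)).
Qed.

Lemma pure_Var n : pureb (Var F n). Proof. by apply/asboolP. Qed.

Lemma abst_pure e t : pureb (abst e t).
Proof.
elim: t => [n|f ts IH] /=; first exact: pure_Var.
by case: (asboolP (A f)) => hf; [apply: pure_App | exact: pure_Var].
Qed.

Lemma optp_pure e t : all pureb (optp e t).1 /\ forall b, all pureb ((optp e t).2 b).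
Proof.
elim: t => [n|f ts IH]; first by rewrite /= pure_Var.
have hb b : all pureb (flatten [seq (optp e (ts i)).2 b | i <- enum 'I_(arity f)]).
  elim: (enum _) => //= i r IHr; rewrite all_cat IHr andbT.
  exact: (IH i).2.
have h1 : all pureb (optp e (App ts)).1.
  rewrite /=; case: (asboolP (A f)) => hf.
    rewrite all_map; apply: sub_all (all_prodl (q := pureb) _ _ _).
    - by move=> b /forallP hb'; exact: pure_App.
    - by move=> i; exact: (IH i).1.
    - by move=> i; exact: pure_Var.
  case: ifP => _; first by rewrite /= pure_Var.
  rewrite !all_cat !all_map hb andbT; apply/andP; split.
    by apply/allP => k _; exact: pure_Var.
  by apply/allP => k _; exact: abst_pure.
split=> // b; rewrite /= all_cat hb andbT.
by move: h1 => /=; set o := if _ then _ else _; case: ifP.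
Qed.

Lemma abst_congr e e' t :
  {in lroots A false true t, e =1 e'} -> abst e t = abst e' t.
Proof.
elim: t => [n|f ts IH] h /=; first by rewrite h ?mem_head.
case: (asboolP (A f)) => hf.
  congr App; apply: funext => i; apply: IH => u hu; apply: h.
  by apply: lroots_flag; apply/lroots_App; exists i; rewrite asboolT.
by rewrite h // lrootsE mem_cat [side _ _]/= asboolF // mem_head.
Qed.

(** Only codes of normal aliens matter, as a reducible alien ranges over all [K] atoms anyway. Hence
    fresh codes for later normal forms change nothing. *)
Lemma optp_congr e e' t : (forall n, nfb P (Var F n)) ->
  ({in lroots A false true t, forall u, nfb P u -> e u = e' u} ->
     (optp e t).1 = (optp e' t).1) /\
  ({in lroots A false false t, forall u, nfb P u -> e u = e' u} ->
     (optp e t).2 = (optp e' t).2).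
Proof.
move=> nfv; elim: t => [n|f ts IH].
  by split=> // h /=; rewrite h ?mem_head.
have below b : {in lroots A false false (App ts), forall u, nfb P u -> e u = e' u} ->
    flatten [seq (optp e (ts i)).2 b | i <- enum 'I_(arity f)] =
    flatten [seq (optp e' (ts i)).2 b | i <- enum 'I_(arity f)].
  move=> h; congr flatten; apply: eq_map => i; rewrite (IH i).2 // => u hu.
  by apply: h; apply/lroots_App; exists i; exact: lroots_flag.
have h1 : {in lroots A false true (App ts), forall u, nfb P u -> e u = e' u} ->
    (optp e (App ts)).1 = (optp e' (App ts)).1.
  move=> h /=.
  have hf : {in lroots A false false (App ts), forall u, nfb P u -> e u = e' u}.
    by move=> u hu; apply: h; exact: lroots_flag.
  case: (asboolP (A f)) => Af.
    congr map; apply: eq_in_prodl => i _; apply: (IH i).1 => u hu.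
    by apply: hf; apply/lroots_App; exists i; rewrite asboolT.
  case: ifP => nft.
    by rewrite h // lrootsE mem_cat [side _ _]/= asboolF // mem_head.
  rewrite below //; congr (_ ++ (_ ++ _)); apply/eq_in_map => u.
  rewrite mem_undup mem_filter => /andP[nfu hu]; apply: abst_congr => w hw.
  have w1 : w \in lroots A false false (App ts).
    have hu' : u \in lroots A true false (App ts) by rewrite /= asboolF.
    exact: (lroots_trans hu' hw).
  exact: (hf w w1 (allP (nfb_lroots _ _ nfu) _ hw)).
split=> // h; apply: funext => b.
case: (asboolP (A f)) => Af; last by rewrite /= asboolF //= below.
have {}h1 : (optp e (App ts)).1 = (optp e' (App ts)).1.
  by apply: h1; rewrite lrootsE [side _ _]/= asboolT.
transitivity ((if ~~ b && ~~ nfb P (App ts) then (optp e (App ts)).1 else [::]) ++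
   flatten [seq (optp e (ts i)).2 true | i <- enum 'I_(arity f)]).
  by rewrite /= asboolT.
by rewrite h1 below //= asboolT.
Qed.

Lemma opt_sum_congr e e' phi t : (forall n, nfb P (Var F n)) ->
  {in lroots A false true t, forall u, nfb P u -> e u = e' u} ->
  opt_sum e phi t = opt_sum e' phi t.
Proof. by move=> nfv h; rewrite /opt_sum /opt ((optp_congr e e' t nfv).1 h). Qed.

Lemma abst_subst e s r : one_sided A true r ->
  abst e (subst s r) = subst (fun v => abst e (s v)) r.
Proof.
elim: r => [//|f rs IH] /one_sided_arg[hf hrs] /=; rewrite hf.
by congr App; apply: funext => i; exact: IH.
Qed.

(** Constructor injectivity gives an equality of dependent pairs; classically decidable equality of
    symbols removes the dependency. *)
Lemma App_inj f (ts ts' : 'I_(arity f) -> term F) : App ts = App ts' -> ts = ts'.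
Proof.
case; exact: (Eqdep_dec.inj_pair2_eq_dec _ (fun x y : F => pselect (x = y))).
Qed.

(** Injective codes keep distinct aliens distinct, which matters for matching non-linear left-hand
    sides. *)
Lemma abst_inj e (X : set (term F)) t t' :
  (forall u v, X u -> X v -> e u = e v -> u = v) ->
  (forall u, u \in lroots A false true t -> X u) ->
  (forall u, u \in lroots A false true t' -> X u) ->
  abst e t = abst e t' -> t = t'.
Proof.
move=> inj_e; have self u : ~~ side A u -> u \in lroots A false true u.
  by rewrite lrootsE mem_cat => /negPf ->; rewrite mem_head.
have abst_alien u : ~~ side A u -> abst e u = Var F (e u).
  by case: u => //= f ts /negPf ->.
have abst_side u : side A u -> forall n, abst e u <> Var F n.
  by case: u => //= f ts ->.
elim: t t' => [n|f ts IH] t' ht ht'.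
  have [st'|st' ] := boolP (side A t').
    by move=> /esym/abst_side; case.
  by rewrite (abst_alien t') // => -[/inj_e]; apply; [apply: ht|apply: ht']; exact: self.
have [st'|st'] := boolP (side A t'); have [st|st] := boolP (side A (App ts)).
- case: t' st' ht' => // f' ts' Af' ht'; have Af : `[< A f >] := st.
  rewrite [abst _ _]/= [abst e (App ts')]/= Af (Af' : `[< A f' >]) => eA.
  have ef : f = f' by case: eA.
  case: f' / ef ts' {Af'} ht' eA => ts' ht' /App_inj eA.
  congr App; apply: funext => i; apply: IH.
  + by move=> u hu; apply: ht; apply: lroots_flag; apply/lroots_App; exists i; rewrite Af.
  + by move=> u hu; apply: ht'; apply: lroots_flag; apply/lroots_App; exists i; rewrite Af.
  + exact: (congr1 (fun g => g i) eA).
- by rewrite (abst_alien (App ts)) // => /esym/abst_side; case.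
- by rewrite (abst_alien t') // => /abst_side; case.
- rewrite !abst_alien // => -[/inj_e]; apply; [apply: ht|apply: ht']; exact: self.
Qed.

End Options.

(** * Effect of one step on the sums *)

Section Expectation.
Context {R : realType} {T : choiceType}.
Variable mu : fdist R T.
Implicit Types f g : T -> R.

Lemma expect_le f g :
  (forall z, z \in (mu : {mset _}%mset) -> f z.2 <= g z.2) ->
  expect f mu <= expect g mu.
Proof.
move=> h; rewrite /expect big_seq [leRHS]big_seq; apply: ler_sum => z zmu.
have [/(_ _ zmu)/andP[z0 _] _] := fdistP mu.
by rewrite ler_wpM2l ?h // ltW.
Qed.

Lemma expect_cstD a f : expect (fun r => a + f r) mu = a + expect f mu.
Proof.
rewrite /expect; under eq_bigr do rewrite mulrDr.
by rewrite big_split /= -mulr_suml (fdistP mu).2 mul1r.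
Qed.

Lemma expect_sum I (s : seq I) (f : I -> T -> R) :
  expect (fun r => \sum_(i <- s) f i r) mu = \sum_(i <- s) expect (f i) mu.
Proof.
rewrite /expect exchange_big; apply: eq_bigr => z _.
by rewrite mulr_sumr.
Qed.

End Expectation.

Lemma ler_sum_all {R : realType} {I : Type} (q : pred I) (s : seq I) (f g : I -> R) :
  all q s -> (forall i, q i -> f i <= g i) ->
  \sum_(i <- s) f i <= \sum_(i <- s) g i.
Proof.
move=> qs h; elim: s qs => [|i s IH] /=; first by rewrite !big_nil.
by case/andP=> qi qs; rewrite !big_cons lerD ?h ?IH.
Qed.

(** * Expected change of the option sums under one innermost step *)

Section Step.
Context {R : realType} {F : signature}.
Variables (A : set F) (P : set (rule R F)) (K : nat).
Variables (d : bool) (l : term F) (s : nat -> term F) (mu : fdist R (term F)).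
Hypothesis Plm : P (l, mu).
Hypothesis l_nonvar : forall v, l <> Var F v.
Hypothesis l_sided : one_sided A d l.
Hypothesis args_nf :
  forall u, proper_subterm u (subst s l) -> normal_form (rewrite_step P) u.
Hypothesis rhs : forall z, z \in (mu : {mset _}%mset) ->
  one_sided A d z.2 /\ vars z.2 `<=` vars l.
Hypothesis nf_var : forall n, nfb P (Var F n).
Variables (e : term F -> nat) (e' : term F -> term F -> nat).
Hypothesis K_gt0 : (0 < K)%N.
Hypothesis e'K : forall r u, (e' r u < K)%N.
Implicit Types (c D C : ctx F) (phi : term F -> R).

Local Notation x := (subst s l).
Local Notation osum := (opt_sum A P K).
Local Notation dsum := (dedup_sum (nfb P)).

Let tau v := abst A e (s v).

Fixpoint pure_ctx C : Prop :=
  if C is CApp f i ts C' then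
    [/\ A f, forall j, pureb A (ts j) & pure_ctx C']
  else True.

Fixpoint top_ctx c : bool :=
  if c is CApp f i ts c' then `[< A f >] && top_ctx c' else true.

(* [d] tells whether the rule belongs to [P1]; [tau] instantiates the rule with the
   pure images of the normal forms matched by its variables. *)
Definition superharmonic (kappa : R) phi : Prop :=
  (forall a, 0 <= phi a) /\
  (d -> forall C, pure_ctx C ->
    kappa + expect (fun r => phi (fill C (subst tau r))) mu <=
    phi (fill C (subst tau l))).

Definition agree c : Prop := forall z, z \in (mu : {mset _}%mset) ->
  {in lroots A false false (fill c x), forall u, nfb P u -> e' z.2 u = e u}.

(** A decrease is claimed only for a [P1]-redex in the top layer, where the pure term itself is
    rewritten. *)
Definition drop (kappa : R) c : R := if d && top_ctx c then kappa else 0.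

Definition step_bound kappa phi c : Prop :=
  drop kappa c + expect (fun r => osum (e' r) phi (fill c (subst s r))) mu <=
  osum e phi (fill c x).

Definition redex_roots c : seq (ctx F) :=
  ctx_roots A true false c ++ hole_root d true (ctx_flag A false c).

Lemma redex_roots_mem c :
  all (fun D => fill D x \in lroots A true false (fill c x)) (redex_roots c).
Proof.
have := perm_mem (perm_lroots_fill A true false c x).
rewrite (lroots_redex s l_nonvar l_sided) => h.
suff : all [in lroots A true false (fill c x)] [seq fill D x | D <- redex_roots c].
  by rewrite all_map.
apply/allP => u; rewrite /redex_roots map_cat mem_cat /= h !mem_cat.
by case/orP=> ->; rewrite !orbT.
Qed.

Lemma agree_root c D :
  fill D x \in lroots A true false (fill c x) -> agree c -> agree D.
Proof.
by move=> hD ac z zmu u hu; apply: ac => //; exact: (lroots_trans hD hu).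
Qed.

(** Roots without the redex keep their option sums, since the codes of their normal aliens agree;
    each root containing the redex contributes its own bound. *)
Lemma roots_bound kappa phi c : superharmonic kappa phi -> agree c ->
  all (fun D => `[< step_bound kappa phi D >]) (redex_roots c) ->
  \sum_(D <- redex_roots c) drop kappa D +
  expect (fun r => dsum (osum (e' r) phi)
                     (lroots A true false (fill c (subst s r)))) mu <=
  dsum (osum e phi) (lroots A true false (fill c x)).
Proof.
move=> [phi0 _] ac hD.
set G := ctx_sibs A true false c ++ lroots A true true x.
have hG u : u \in G -> u \in lroots A true false (fill c x).
  rewrite (perm_mem (perm_lroots_fill A true false c x)).
  rewrite (lroots_redex s l_nonvar l_sided) !mem_cat.
  by case/orP=> ->; rewrite ?orbT.
rewrite (dedup_sum_redex s Plm l_nonvar l_sided) -/(redex_roots c) -/G.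
apply: (@le_trans _ _ (\sum_(D <- redex_roots c) drop kappa D +
  (dsum (osum e phi) G + \sum_(D <- redex_roots c)
     expect (fun r => osum (e' r) phi (fill D (subst s r))) mu))).
  rewrite lerD2l -expect_sum -expect_cstD; apply: expect_le => z zmu.
  have [hr rl] := rhs zmu.
  apply: le_trans (dedup_sum_reduct l_nonvar l_sided args_nf _ _ _ _ hr rl) _.
    by move=> u; exact: opt_sum_ge0.
  rewrite -/(redex_roots c) -/G lerD2r.
  rewrite (@eq_in_dedup_sum _ _ _ _ (osum e phi)) // => u /hG hu.
  apply: opt_sum_congr => // w hw; apply: ac => //; exact: (lroots_trans hu hw).
rewrite addrCA lerD2l -big_split /=; apply: ler_sum_all hD _ => D.
by move/asboolP.
Qed.

(** Fixing pure siblings preserves superharmonicity because the definition quantifies over all pure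
    contexts; this drives the induction through a layer. *)
Lemma superharmonic_arg kappa phi f (b : 'I_(arity f) -> term F) i :
  superharmonic kappa phi -> A f -> (forall j, pureb A (b j)) ->
  superharmonic kappa (fun a => phi (App (upd b i a))).
Proof.
move=> [phi0 h] Af hb; split=> // hd C hC.
by apply: (h hd (CApp i b C)).
Qed.

(** Innermost evaluation makes all aliens of the redex normal, so redex and reduct each have one
    option, and these are the instances of the rule under [tau]. *)
Lemma step_bound_hole kappa phi : d -> superharmonic kappa phi -> agree Hole ->
  step_bound kappa phi Hole.
Proof.
move=> hd [phi0 h] ac; rewrite /step_bound /drop hd /=.
have hl : one_sided A true l by rewrite -hd.
have sx : lroots A false true x = lroots A false false x.
  by rewrite lrootsE (redex_side s l_nonvar l_sided) hd.
have nfx : all (nfb P) (lroots A false true x).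
  by rewrite sx; exact: redex_inner_nf.
rewrite {2}/opt_sum opt_resolved // big_seq1 abst_subst //.
apply: le_trans (h hd Hole I); rewrite lerD2l; apply: expect_le => z zmu /=.
have [hr rl] := rhs zmu; rewrite hd in hr.
have inx v u : vars z.2 v -> u \in lroots A false true (s v) ->
    u \in lroots A false true x.
  move=> hv hu; apply/(lroots_subst_other _ _ (cc := false)) => //.
  by exists v => //; exact: rl.
rewrite {1}/opt_sum opt_resolved; last first.
  apply/allP => u /(lroots_subst_other _ _ (cc := false))-/(_ hr)[v hv hu].
  exact: (allP nfx _ (inx _ _ hv hu)).
rewrite big_seq1 abst_subst // (@subst_eq_on _ _ tau) // => v hv.
apply: abst_congr => u hu; have hux := inx _ _ hv hu.
by apply: ac => //; [rewrite /= -sx | exact: (allP nfx)].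
Qed.

Lemma step_bound_app kappa phi f i (ts : 'I_(arity f) -> term F) c :
  0 <= kappa -> A f -> superharmonic kappa phi -> agree (CApp i ts c) ->
  (forall psi, superharmonic kappa psi -> step_bound kappa psi c) ->
  step_bound kappa phi (CApp i ts c).
Proof.
move=> kappa0 Af hphi ac IH.
have asA : `[< A f >] by exact/asboolP.
pose s0 := enum 'I_(arity f); pose b0 := fun _ : 'I_(arity f) => Var F 0.
have expand e0 y : osum e0 phi (fill (CApp i ts c) y) =
  \sum_(b <- prodl (fun j => opt A P K e0 (ts j)) (rem i s0) b0)
    osum e0 (fun a => phi (App (upd b i a))) (fill c y).
  rewrite /opt_sum [fill _ _]/= opt_A // big_map.
  rewrite [LHS](@sum_prodl_rem _ _ _ _ _ _ i) ?enum_uniq ?mem_enum //= eqxx.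
  congr (\sum_(b <- _) _); apply: eq_in_prodl => j.
  by rewrite mem_rem_uniq ?enum_uniq // inE => /andP[/negPf -> _].
rewrite /step_bound expand.
set B := prodl _ _ _.
have -> : expect (fun r => osum (e' r) phi (fill (CApp i ts c) (subst s r))) mu =
   \sum_(b <- B) expect (fun r => osum (e' r) (fun a => phi (App (upd b i a)))
      (fill c (subst s r))) mu.
  rewrite -expect_sum; apply: eq_big_seq => z zmu; rewrite expand.
  congr (_ * \sum_(b <- _) _); apply: eq_in_prodl => j.
  rewrite mem_rem_uniq ?enum_uniq // inE => /andP[/negPf ji _].
  apply: (@optp_congr _ _ A P K (e' z.2) e (ts j) nf_var).1 => u hu; apply: ac => //.
  by apply/lroots_App; exists j; rewrite ji asA.
(* The decrease occurs once per choice of sibling options, so at least one choice must exist. *)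
have B0 : (0 < size B)%N by apply: prodl_size => j; exact: opt_size.
have Bp : all (fun b : 'I_(arity f) -> term F => [forall j, pureb A (b j)]) B.
  apply: all_prodl => j; last exact: pure_Var.
  exact: (optp_pure _ _ _ _ _).1.
rewrite {1}/drop /= asA /= -/(drop kappa c).
have drop0 : 0 <= drop kappa c by rewrite /drop; case: ifP.
apply: (@le_trans _ _ (\sum_(b <- B) (drop kappa c + expect (fun r =>
   osum (e' r) (fun a => phi (App (upd b i a))) (fill c (subst s r))) mu))).
  rewrite big_split /= lerD2r; case: (B) B0 => // b B' _.
  by rewrite big_cons lerDl sumr_ge0.
apply: ler_sum_all Bp _ => b /forallP hb.
by apply: IH; exact: superharmonic_arg.
Qed.

(** Induction on the depth of the hole. A symbol of [A] is absorbed into the test function; at an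
    alien, the bounds of the inner layers around the redex are added, and these have shallower
    contexts. *)
Lemma step_boundP c kappa phi : 0 <= kappa -> superharmonic kappa phi ->
  agree c -> step_bound kappa phi c.
Proof.
move=> kappa0; have [n] := ubnP (ctx_depth c).
elim: n c phi => // n IH c phi; rewrite ltnS => hc hphi ac.
have [phi0 _] := hphi.
have alien : ~~ side A (fill c x) ->
    all (fun D => ctx_depth D < n)%N (redex_roots c) -> step_bound kappa phi c.
  move=> sc hD.
  have /(roots_bound hphi ac) h :
      all (fun D => `[< step_bound kappa phi D >]) (redex_roots c).
    have := redex_roots_mem c.
    elim: (redex_roots c) hD => //= D Ds IHD /andP[hD hDs] /andP[mD mDs].
    rewrite IHD // andbT; apply/asboolP; apply: IH => //.
    exact: agree_root mD ac.
  have dr : drop kappa c = 0.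
    rewrite /drop; case: c sc {hc ac hD h} => [|f i ts c] /=.
      by rewrite (redex_side s l_nonvar l_sided) => /negPf ->.
    by move=> /negPf ->; rewrite andbF.
  have := redex_not_nf s Plm c.
  have [f [ts et]] : exists f (ts : 'I_(arity f) -> term F), fill c x = App ts.
    case: (c) => [|f i ts c'] /=; last by exists f; eexists.
    by case: l l_nonvar => [v /(_ v)//|f ls _]; exists f; eexists.
  rewrite /step_bound dr add0r; move: sc h; rewrite et => sc h nft.
  (* Before the step the alien is reducible and its sum is known exactly; afterwards it may be
     resolved or collapsed, so only the upper bound is available. *)
  rewrite opt_sum_alien //; apply: (@le_trans _ _ (\sum_(k <- iota 0 K) phi (Var F k) +
    expect (fun r => dsum (osum (e' r) phi)
                       (lroots A true false (fill c (subst s r)))) mu)).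
    by rewrite -expect_cstD; apply: expect_le => z _; exact: opt_sum_le.
  rewrite lerD2l; apply: le_trans h; rewrite lerDr; apply: sumr_ge0 => D _.
  by rewrite /drop; case: ifP.
case: c hc hphi ac alien => [|f i ts c] hc hphi ac alien.
  have [hd|hd] := boolP d; first exact: step_bound_hole.
  apply: alien; first by rewrite /= (redex_side s l_nonvar l_sided).
  by rewrite /redex_roots /hole_root (negPf hd).
case: (boolP `[< A f >]) => [/asboolP Af|nA].
  apply: step_bound_app => // psi hpsi; apply: IH => // z zmu u hu.
  apply: ac => //; apply/lroots_App; exists i; rewrite eqxx.
  exact: lroots_flag.
apply: alien => //; rewrite /redex_roots all_cat /= (negPf nA) /=.
rewrite (sub_all _ (ctx_roots_depth A true false c)) /=; last first.
  by move=> D hD; exact: leq_ltn_trans hc.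
by rewrite /hole_root; case: ifP => //= _; rewrite andbT (leq_ltn_trans _ hc).
Qed.

Lemma redex_roots_top c : d ->
  has top_ctx (redex_roots c).
Proof.
move=> hd; rewrite /redex_roots.
(* For an arbitrary flag, the redex may instead belong to a layer that starts above [c]; the last
   disjunct covers this case. *)
suff : forall b, has top_ctx (ctx_roots A true b c ++
    hole_root d true (ctx_flag A b c)) || b && top_ctx c.
  by move=> /(_ false); rewrite orbF.
elim: c => [|f i ts c IH] b; first by rewrite /hole_root hd; case: b.
have := IH `[< A f >]; rewrite /= -catA [X in _ -> X || _]has_cat.
case: (asboolP (A f)) => Af /=; last by rewrite orbF => ->.
case/orP=> [->|hc]; first by rewrite orbT.
by case: b => /=; rewrite hc ?asboolT ?orbT.
Qed.

Lemma measure_bound phi c : superharmonic 1 phi -> agree c ->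
  (if d then 1 else 0) +
  expect (fun r => dsum (osum (e' r) phi)
                     (lroots A true false (fill c (subst s r)))) mu <=
  dsum (osum e phi) (lroots A true false (fill c x)).
Proof.
move=> hphi ac; have hD : all (fun D => `[< step_bound 1 phi D >]) (redex_roots c).
  apply: sub_all (redex_roots_mem c) => D mD; apply/asboolP.
  by apply: step_boundP => //; exact: agree_root mD ac.
apply: le_trans (roots_bound hphi ac hD); rewrite lerD2r.
have drop0 D : 0 <= drop 1 D by rewrite /drop; case: ifP.
case hd: d; last exact: sumr_ge0.
move: (redex_roots_top c hd); elim: (redex_roots c) => //= D Ds IHD.
rewrite big_cons => /orP[tD|/IHD h]; last by rewrite -[leLHS]add0r lerD.
by rewrite {1}/drop hd tD lerDl sumr_ge0.
Qed.

End Step.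

(** * Finite codings and their extension by fresh codes *)

(** * Codings of aliens *)

Lemma extend_coding (T : eqType) (K : nat) (e : T -> nat) (X Y : seq T) :
  (forall u, e u < K)%N -> {in X &, injective e} ->
  (size (undup (X ++ Y)) <= K)%N ->
  exists e' : T -> nat, [/\ forall u, (e' u < K)%N, {in X, e' =1 e} &
    {in X ++ Y &, injective e'}].
Proof.
elim: Y X e => [|y Y IH] X e eK inj_e; first by rewrite cats0; exists e.
have mem_eq : X ++ y :: Y =i (y :: X) ++ Y.
  by move=> u; rewrite !(mem_cat, inE) orbCA orbA.
rewrite (perm_size (perm_undup mem_eq)) => hsize.
have [yX|yX] := boolP (y \in X).
  have mem_eq' : (y :: X) ++ Y =i X ++ Y.
    by move=> u; rewrite !(mem_cat, inE); case: eqP => // ->; rewrite yX.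
  have [|e' [e'K e'e inj']] := IH X e eK inj_e.
    by rewrite -(perm_size (perm_undup mem_eq')).
  by exists e'; split=> // u v; rewrite !mem_eq !mem_eq'; exact: inj'.
(* A free code for [y] exists by the pigeonhole principle. *)
have [k kK kX] : exists2 k, (k < K)%N & k \notin map e X.
  apply: contrapT => h.
  have sub : {subset iota 0 K <= map e (undup X)}.
    move=> k; rewrite mem_iota /= add0n => kK.
    have [/mapP[u uX ->]|kX] := boolP (k \in map e X); last by case: h; exists k.
    by apply/mapP; exists u; rewrite ?mem_undup.
  have := uniq_leq_size (iota_uniq 0 K) sub; rewrite size_iota size_map leqNgt.
  suff -> : (size (undup X) < K)%N by [].
  apply: leq_trans hsize.
  have -> : (size (undup X)).+1 = size (undup (y :: X)) by rewrite /= (negPf yX).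
  apply: uniq_leq_size; rewrite ?undup_uniq // => u; rewrite !mem_undup mem_cat.
  by move=> ->.
pose e1 u := if u == y then k else e u.
have e1X : {in X, e1 =1 e}.
  by move=> u uX; rewrite /e1; case: eqP => // eu; rewrite -eu uX in yX.
have kE u : u \in X -> e u = k -> False.
  by move=> uX eu; move: kX; rewrite -eu map_f.
have [| |e' [e'K e'e inj']] := IH (y :: X) e1 _ _ hsize.
- by move=> u; rewrite /e1; case: ifP.
- move=> u v; rewrite !inE => /predU1P[->|uX] /predU1P[->|vX] //.
  + by rewrite [e1 y]/e1 eqxx e1X // => /esym/(kE _ vX).
  + by rewrite [e1 y]/e1 eqxx e1X // => /(kE _ uX).
  + by rewrite !e1X //; exact: inj_e.
exists e'; split=> // [u uX|u v]; first by rewrite e'e ?e1X // inE uX orbT.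
by rewrite !mem_eq; exact: inj'.
Qed.

(** * Abstraction preserves normal forms *)

Section AbstractionNF.
Context {R : realType} {F : signature}.
Variables (A : set F) (e : term F -> nat) (X : set (term F)).
Hypothesis inj_e : forall u v, X u -> X v -> e u = e v -> u = v.

Local Notation atoms_in_X w := (forall u, u \in lroots A false true w -> X u).

Lemma atoms_arg f (ts : 'I_(arity f) -> term F) i :
  A f -> atoms_in_X (App ts) -> atoms_in_X (ts i).
Proof.
move=> Af h u hu; apply: h; apply: lroots_flag; apply/lroots_App; exists i.
by rewrite asboolT.
Qed.

Lemma abst_App w f (ts : 'I_(arity f) -> term F) : abst A e w = App ts ->
  exists2 ws : 'I_(arity f) -> term F, w = App ws &
    A f /\ forall i, abst A e (ws i) = ts i.
Proof.
case: w => //= g ws; case: (asboolP (A g)) => // Ag eA.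
have eg : g = f by case: eA.
case: f / eg ts eA => ts /App_inj eA; exists ws => //; split=> // i.
by rewrite -eA.
Qed.

Lemma abst_match w l tau : one_sided A true l -> abst A e w = subst tau l ->
  atoms_in_X w -> exists s, w = subst s l.
Proof.
move=> hl ew hw.
(* Each variable of [l] gets a subterm of [w] at one of its occurrences; [Var F 0] is a dummy for
   all other variables. *)
have h v : exists w', vars l v -> abst A e w' = tau v /\ atoms_in_X w'.
  have [hv|hv] := pselect (vars l v); last by exists (Var F 0).
  suff [w' h] : exists w', abst A e w' = tau v /\ atoms_in_X w' by exists w'.
  elim: l w hl ew hw hv => [n|f ls IH] w hl ew hw.
    by move=> ->; exists w.
  case=> i _ hv; have [_ hls] := one_sided_arg hl.
  have [ws eqw [Af ews]] := abst_App ew.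
  apply: (IH i (ws i)) => //; apply: atoms_arg Af _; by rewrite -eqw.
have [s hs] := choice h; exists s.
(* Different occurrences of a variable carry equal abstractions, hence equal subterms by
   injectivity. *)
apply: (abst_inj inj_e hw) => [u|].
  case/(lroots_subst_other _ _ (cc := false) hl) => v hv; exact: (hs v hv).2.
by rewrite ew abst_subst //; apply: subst_eq_on => v hv; rewrite (hs v hv).1.
Qed.

(** A match in the abstraction lifts to a match in [w]. This keeps the abstracted step innermost. *)
Lemma abst_nf (P Q : set (rule R F)) w : Q `<=` P ->
  (forall l mu, Q (l, mu) -> one_sided A true l) ->
  normal_form (rewrite_step P) w -> atoms_in_X w ->
  normal_form (rewrite_step Q) (abst A e w).
Proof.
move=> QP hQ nfw hw; apply/nfP => c l mu tau Qlm.
elim: c w nfw hw => [|f i ts c IH] w nfw hw ew.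
  have [s es] := abst_match (hQ _ _ Qlm) ew hw.
  by have /nfP/(_ Hole l mu s (QP _ Qlm)) := nfw; rewrite es.
have [ws eqw [Af ews]] := abst_App ew.
apply: (IH (ws i)); last by rewrite ews eqxx.
- by apply: nf_arg; rewrite -eqw.
- by apply: atoms_arg Af _; rewrite -eqw.
Qed.

End AbstractionNF.

Section PureSteps.
Context {R : realType} {F : signature}.
Variables (A : set F).

Lemma pure_fill (C : ctx F) a : pure_ctx A C -> pureb A a -> pureb A (fill C a).
Proof.
elim: C => [//|f i ts C IH] /= [Af hts hC] ha; apply: pure_App => // j.
by case: eqP => // _; exact: IH.
Qed.

Lemma pure_subst s (l : term F) : one_sided A true l ->
  (forall v, pureb A (s v)) -> pureb A (subst s l).
Proof.
move=> hl hs; apply/asboolP => g /symbols_subst[/hl/asboolP//|[v _]].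
exact: (asboolW (hs v)).
Qed.

End PureSteps.

Lemma disjoint_symbols_sided {R : realType} {F : signature}
    (P1 P2 : set (rule R F)) l mu :
  ptrs_symbols P1 `&` ptrs_symbols P2 = set0 -> (P1 `|` P2) (l, mu) ->
  let d := `[< P1 (l, mu) >] in
  one_sided (ptrs_symbols P1) d l /\
  forall z, z \in (mu : {mset _}%mset) -> one_sided (ptrs_symbols P1) d z.2.
Proof.
move=> hdisj Plm /=; case: asboolP => [h1|h1].
  split=> [g hg|z zmu g hg]; apply/asboolP; exists l, mu; split=> //; first by left.
  by right; exists z.
have h2 : P2 (l, mu) by case: Plm.
have no g : ptrs_symbols P2 g -> `[< ptrs_symbols P1 g >] = false.
  move=> g2; apply/asboolP => g1.
  by have : (ptrs_symbols P1 `&` ptrs_symbols P2) g by []; rewrite hdisj.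
split=> [g hg|z zmu g hg]; apply: no; exists l, mu; split=> //; first by left.
by right; exists z.
Qed.

(** * The potential *)

Section Potential.
Context {R : realType} {F : signature}.
Variables P1 P2 : set (rule R F).
Hypotheses (hP1 : is_PTRS P1) (hP2 : is_PTRS P2).
Hypothesis hdisj : ptrs_symbols P1 `&` ptrs_symbols P2 = set0.
Variable v1 : term F -> R.
Hypothesis v1_ge0 : forall t, 0 <= v1 t.
Hypothesis v1_rank : ranking (innermost_step P1) (ptrs_terms P1) v1.

Local Notation A := (ptrs_symbols P1).
Local Notation P := (P1 `|` P2).

Lemma rule_wf l mu : P (l, mu) -> (forall v, l <> Var F v) /\
  forall z, z \in (mu : {mset _}%mset) -> vars z.2 `<=` vars l.
Proof. by case=> [/hP1.2|/hP2.2] []. Qed.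

Lemma nfb_Var n : nfb P (Var F n).
Proof.
apply/asboolP/nfP => c l mu s /rule_wf[hl _].
by case: c => //=; case: l hl => [v /(_ v)|].
Qed.

Definition nf_atoms t : seq (term F) :=
  [seq u <- lroots A false false t | nfb P u].

(* [K] leaves room for a fresh code for every alien that is not yet in normal
   form. *)
Definition valid_coding (K : nat) (e : term F -> nat) (t : term F) : Prop :=
  [/\ forall u, (e u < K)%N, {in nf_atoms t &, injective e} &
      dedup_sum (nfb P) (fun=> 1) (lroots A false false t) <= K%:R :> R].

Definition bound_of K e t : R :=
  dedup_sum (nfb P) (opt_sum A P K e v1) (lroots A true false t).

Definition bounds t : set R :=
  [set w | exists K e, valid_coding K e t /\ w = bound_of K e t].

(** The abstracted redex in a pure context admits an innermost [P1]-step on a [P1]-term, so the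
    ranking property of [v1] applies. *)
Lemma superharmonic_v1 l mu s e t c : P (l, mu) ->
  (forall u, proper_subterm u (subst s l) -> normal_form (rewrite_step P) u) ->
  t = fill c (subst s l) -> {in nf_atoms t &, injective e} ->
  superharmonic A `[< P1 (l, mu) >] l s mu e 1 v1.
Proof.
move=> Plm hargs et inj_e; split=> // /asboolP h1 C hC.
have [hl _] := disjoint_symbols_sided hdisj Plm; rewrite asboolT // in hl.
set tau := fun v => abst A e (s v).
rewrite -(expect_map v1 (fun r => fill C (subst tau r)) mu).
have [|_] := v1_rank (t := fill C (subst tau l)).
  apply: (asboolW (P := terms_over A _)); apply: pure_fill => //.
  by apply: pure_subst => // v; exact: abst_pure.
apply; apply/innermost_stepP; exists C, l, mu, tau; split=> //.
have [lnv _] := rule_wf Plm.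
pose X u := u \in nf_atoms t.
have injX u v : X u -> X v -> e u = e v -> u = v by move=> hu hv; exact: inj_e.
have atX u : u \in lroots A false false (subst s l) -> X u.
  move=> hu; rewrite /X mem_filter; apply/andP; split.
    by apply: (allP _ u hu); exact: redex_inner_nf.
  rewrite et (perm_mem (perm_lroots_fill A false false c _)) !mem_cat.
  by rewrite (lroots_flag _ hu) orbT.
case: l Plm h1 hl lnv hargs et atX => [v|f ls] Plm h1 hl lnv hargs et atX.
  by case: (lnv v).
move: hargs => /proper_subterms_nf hargs; apply/proper_subterms_nf => i.
have [/asboolP Af hls] := one_sided_arg hl.
rewrite -/(subst tau (ls i)) -abst_subst //.
apply: (abst_nf injX (P := P)) => //.
- move=> l' mu' h1'; have [h _] := disjoint_symbols_sided hdisj (or_introl h1').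
  by rewrite asboolT in h.
- move=> u hu; apply: atX; apply/lroots_App; exists i.
  by rewrite asboolT.
Qed.

(** A coding of the redex extends, separately for each outcome, to a coding with the same [K],
    because the count bounded by [K] does not grow. *)
Lemma bound_step l mu s c w : P (l, mu) ->
  (forall u, proper_subterm u (subst s l) -> normal_form (rewrite_step P) u) ->
  bounds (fill c (subst s l)) w ->
  exists w' : term F -> R,
    (forall z, z \in (mu : {mset _}%mset) -> bounds (fill c (subst s z.2)) (w' z.2)) /\
    (if `[< P1 (l, mu) >] then 1 else 0) + expect w' mu <= w.
Proof.
move=> Plm hargs [K [e [[eK inj_e cnt] ->]]].
have [lnv hv] := rule_wf Plm.
have [hl hr] := disjoint_symbols_sided hdisj Plm.
have ext r : exists e' : term F -> nat, (forall u, (e' u < K)%N) /\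
   ((exists2 z, z \in (mu : {mset _}%mset) & z.2 = r) ->
     {in nf_atoms (fill c (subst s l)), e' =1 e} /\
     valid_coding K e' (fill c (subst s r))).
  have [[z zmu zr]|no] := pselect (exists2 z, z \in (mu : {mset _}%mset) & z.2 = r);
    last by exists e.
  have rs : one_sided A `[< P1 (l, mu) >] r by rewrite -zr; exact: hr.
  have rv : vars r `<=` vars l by rewrite -zr; exact: hv.
  have [|e' [e'K e'e inj']] :=
    extend_coding (Y := nf_atoms (fill c (subst s r))) eK inj_e.
    rewrite -(ler_nat R); apply: le_trans cnt.
    exact: (size_nf_roots_reduct s Plm lnv hl false false c rs rv).
  exists e'; split=> // _; split=> //; split=> //.
    by move=> u v hu hv'; apply: inj'; rewrite mem_cat ?hu ?hv' orbT.
  apply: le_trans cnt; rewrite (dedup_sum_redex s Plm lnv hl).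
  apply: dedup_sum_reduct => //.
have [e' he'] := choice ext.
exists (fun r => bound_of K (e' r) (fill c (subst s r))); split.
  move=> z zmu; exists K, (e' z.2); split=> //.
  by case: (he' z.2) => _ []; first by exists z.
have K0 : (0 < K)%N by apply: leq_ltn_trans (eK (Var F 0)).
apply: measure_bound => //.
- by move=> z zmu; split; [exact: hr | exact: hv].
- exact: nfb_Var.
- by move=> r; exact: (he' r).1.
- exact: superharmonic_v1 Plm hargs erefl inj_e.
- move=> z zmu u hu nfu; have [|h _] := (he' z.2).2; first by exists z.
  by apply: h; rewrite mem_filter nfu.
Qed.

Lemma bounds_ge0 t w : bounds t w -> 0 <= w.
Proof.
move=> [K [e [_ ->]]]; apply: dedup_sum_ge0 => u; exact: opt_sum_ge0.
Qed.

Lemma bounds_nonempty t : bounds t !=set0.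
Proof.
(* The successor ensures that a code exists even if there are no aliens. *)
pose G := lroots A false false t; pose K := (size G).+1.
have [|||e [eK _ inj_e]] := @extend_coding _ K (fun=> 0%N) [::] (nf_atoms t).
- by [].
- by [].
- by rewrite leqW // (leq_trans (size_undup _)) // size_filter count_size.
exists (bound_of K e t), K, e; split=> //; split=> //.
apply: (@le_trans _ _ (dedup_sum (nfb P) (fun=> 1) [::] + \sum_(u <- G) 1)).
  by rewrite -[lroots _ _ _ _]cat0s; apply: dedup_sum_cat_le => u; exact: ler01.
by rewrite /dedup_sum !big_nil !add0r sum1_size_seq ler_nat.
Qed.

Lemma potential_exists : exists W : term F -> R, (forall t, 0 <= W t) /\
  forall c l mu s, P (l, mu) ->
  (forall u, proper_subterm u (subst s l) -> normal_form (rewrite_step P) u) ->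
  (if `[< P1 (l, mu) >] then 1 else 0) +
    expect (fun r => W (fill c (subst s r))) mu <= W (fill c (subst s l)).
Proof.
exists (fun t => inf (bounds t)); split=> [t|c l mu s Plm hargs].
  by apply: lb_le_inf; [exact: bounds_nonempty | move=> w /bounds_ge0].
apply: lb_le_inf; first exact: bounds_nonempty.
(* Any bound [w] before the step yields bounds for the outcomes, and each infimum lies below the
   corresponding one. *)
move=> w /(bound_step Plm hargs)[w' [hw']].
apply: le_trans; rewrite lerD2l; apply: expect_le => z zmu.
by apply: ge_inf; [exists 0 => ? /bounds_ge0 | exact: hw'].
Qed.

End Potential.

(** * Modularity of innermost SAST *)

Lemma is_PTRS_union {R : realType} {F : signature} (P1 P2 : set (rule R F)) :
  is_PTRS P1 -> is_PTRS P2 -> is_PTRS (P1 `|` P2).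
Proof.
move=> [c1 h1] [c2 h2]; split; last by move=> l mu [/h1|/h2].
by rewrite -bigcup2E; apply: bigcup_countable => // -[|[|]] //=.
Qed.

Lemma innermost_potential {R : realType} {F : signature} (P1 P2 : set (rule R F)) :
  is_PTRS P1 -> is_PTRS P2 -> ptrs_symbols P1 `&` ptrs_symbols P2 = set0 ->
  SAST (innermost_step P1) (ptrs_terms P1) ->
  exists W : term F -> R, (forall t, 0 <= W t) /\
  forall c l mu s, (P1 `|` P2) (l, mu) ->
  (forall u, proper_subterm u (subst s l) ->
     normal_form (rewrite_step (P1 `|` P2)) u) ->
  (if `[< P1 (l, mu) >] then 1 else 0) +
    expect (fun r => W (fill c (subst s r))) mu <= W (fill c (subst s l)).
Proof.
move=> hP1 hP2 hdisj h1.
have r1 := SAST_ranking (ptrs_terms_closed hP1) h1.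
(* Nonnegativity is required on all terms; [fine] sends an infinite height to 0. *)
apply: potential_exists r1 => // t; apply: fine_ge0; exact: edh_ge0.
Qed.

(** The two potentials are added: a rule lowers the potential of its own system by one and does not
    raise the other in expectation. *)
Lemma SAST_union {R : realType} {F : signature} (P1 P2 : set (rule R F)) :
  is_PTRS P1 -> is_PTRS P2 -> ptrs_symbols P1 `&` ptrs_symbols P2 = set0 ->
  SAST (innermost_step P1) (ptrs_terms P1) ->
  SAST (innermost_step P2) (ptrs_terms P2) ->
  SAST (innermost_step (P1 `|` P2)) (ptrs_terms (P1 `|` P2)).
Proof.
move=> hP1 hP2 hdisj h1 h2.
have [W1 [W1_ge0 step1]] := innermost_potential hP1 hP2 hdisj h1.
have [|W2 [W2_ge0 step2]] := innermost_potential hP2 hP1 _ h2; first by rewrite setIC.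
rewrite [P2 `|` P1]setUC in step2.
apply: (@ranking_SAST _ _ _ _ (fun t => W1 t + W2 t)).
  exact: ptrs_terms_closed (is_PTRS_union hP1 hP2).
move=> t _; split; first exact: addr_ge0.
move=> nu /innermost_stepP[c [l [mu [s [Plm -> -> hargs]]]]].
rewrite expect_map /expect.
under eq_bigr do rewrite mulrDr.
rewrite big_split /=.
apply: le_trans (lerD (step1 c _ _ _ Plm hargs) (step2 c _ _ _ Plm hargs)).
rewrite [leRHS]addrACA lerD2r.
by case: Plm => hlm; rewrite (asboolT hlm); case: ifP;
  rewrite ?addr0 ?add0r ?lerDl ?ler01.
Qed.

(** On [P1]-terms every innermost [P1]-step is innermost for the union: a [P2]-redex would put the
    root symbol of a [P2]-rule into a [P1]-term. *)
Lemma SAST_component {R : realType} {F : signature} (P1 P2 : set (rule R F)) :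
  is_PTRS P1 -> is_PTRS P2 -> ptrs_symbols P1 `&` ptrs_symbols P2 = set0 ->
  SAST (innermost_step (P1 `|` P2)) (ptrs_terms (P1 `|` P2)) ->
  SAST (innermost_step P1) (ptrs_terms P1).
Proof.
move=> hP1 hP2 hdisj h.
have r := SAST_ranking (ptrs_terms_closed (is_PTRS_union hP1 hP2)) h.
set W := (fun t => fine _) in r.
apply: (@ranking_SAST _ _ _ _ W (ptrs_terms_closed hP1)) => t Dt.
have sub : ptrs_terms P1 `<=` ptrs_terms (P1 `|` P2).
  move=> u hu g /hu[l [mu [Plm hg]]]; exists l, mu; split=> //; by left.
have [r0 rstep] := r t (sub _ Dt); split=> // nu.
move=> /innermost_stepP[c [l [mu [s [Plm et enu hargs]]]]]; apply: rstep.
apply/innermost_stepP; exists c, l, mu, s; split=> //; first by left.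
move=> u hu; have /nfP nfu := hargs u hu; apply/nfP => c' l' mu' s' [].
  exact: nfu.
move=> P2lm eu; have [_ /(_ _ _ P2lm)[lnv _]] := hP2.
have [pi _ /subterm_at_ctx[c2 [ec2 _]]] := hu.
case: l' lnv eu P2lm => [v /(_ v)//|f ls _ eu P2lm].
have : (ptrs_symbols P1 `&` ptrs_symbols P2) f; last by rewrite hdisj.
split; last by exists (App ls), mu'; split=> //; left; left.
apply: Dt; rewrite et; apply: symbols_fill_hole; rewrite ec2.
by apply: symbols_fill_hole; rewrite eu; apply: symbols_fill_hole; left.
Qed.

Theorem theorem7p8 (R : realType) (F : signature) (P1 P2 : set (rule R F))
    (hP1 : is_PTRS P1) (hP2 : is_PTRS P2)
    (hdisj : ptrs_symbols P1 `&` ptrs_symbols P2 = set0) :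
  SAST (innermost_step (P1 `|` P2)) (ptrs_terms (P1 `|` P2)) <->
  (SAST (innermost_step P1) (ptrs_terms P1) /\
   SAST (innermost_step P2) (ptrs_terms P2)).
Proof.
split=> [h|[h1 h2]]; last exact: SAST_union.
split; first exact: SAST_component hP1 hP2 hdisj h.
by apply: (SAST_component hP2 hP1); [rewrite setIC | rewrite setUC].
Qed.
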